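(* Let $r$, $r'$, and $M$ be positive real numbers such that $r'>r$. There exists a function $\gamma$ satisfying $|\gamma(\varepsilon)|\le1$ for all $\varepsilon>0$, such that the metric entropy of the class $\mathcal{A}(r';M)$ equipped with the metric $d_r$ can be expressed as $$H\left(\varepsilon;\mathcal{A}(r';M),d_r\right)=\frac{\log^2(\varepsilon^{-1})}{\log(r'/r)}+\frac{\log(\varepsilon^{-1})}{\log(r'/r)}\,\log^{(2)}(\varepsilon^{-1})\left(\gamma(\varepsilon)+o_{\varepsilon\to0}(1)\right).$$
   Context: $\log$ is the logarithm to base $2$, $\log^{(2)}=\log\circ\log$, and $\log^2(x)=(\log x)^2$. $D(0;\rho)$ is the open disk in $\mathbb{C}$ centered at $0$ of radius $\rho$. $\mathcal{A}(r';M)$ is the class of functions $f$ that are analytic on $D(0;r')$ and satisfy $\sup_{z\in D(0;r')}|f(z)|\le M$. The metric is $d_r(f_1,f_2)=\sup_{z\in D(0;r)}|f_1(z)-f_2(z)|$. Metric entropy: for a subset $\mathcal{K}$ of a metric space $(\mathcal{X},d)$, an $\varepsilon$-covering is a set $\{x_1,\dots,x_N\}\subseteq\mathcal{X}$ such that every $x\in\mathcal{K}$ has some $i$ with $d(x,x_i)\le\varepsilon$; $N(\varepsilon;\mathcal{K},d)$ is the cardinality of a smallest $\varepsilon$-covering and $H(\varepsilon;\mathcal{K},d)=\log_2N(\varepsilon;\mathcal{K},d)$. Here the ambient space $\mathcal{X}$ is the space of bounded analytic functions on $D(0;r)$ with the metric $d_r$ (elements of $\mathcal{A}(r';M)$ being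 restricted to $D(0;r)$). *)

(* Defs.v *)
From Stdlib Require Import Reals List.
From Coquelicot Require Import Coquelicot.

Open Scope R_scope.

Definition log2 (x : R) : R := ln x / ln 2.

Definition in_disk (rho : R) (z : C) : Prop := Cmod z < rho.

(** Functions on a disk are represented by total functions [C -> C] whose
    values off the disk are irrelevant; restriction to a smaller disk is then
    implicit. *)

Definition analytic_on_disk (rho : R) (f : C -> C) : Prop :=
  forall z0 : C, in_disk rho z0 ->
    exists (a : nat -> C) (delta : R), 0 < delta /\
      forall z : C, in_disk rho z -> Cmod (Cminus z z0) < delta ->
        @is_pseries C_AbsRing C_NormedModule a (Cminus z z0) (f z).

Definition disk_sup (rho : R) (f : C -> C) : Rbar :=
  Lub_Rbar (fun x : R => exists z : C, in_disk rho z /\ x = Cmod (f z)).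

Definition analytic_class (rho M : R) (f : C -> C) : Prop :=
  analytic_on_disk rho f /\ Rbar_le (disk_sup rho f) (Finite M).

Definition bounded_analytic (rho : R) (f : C -> C) : Prop :=
  analytic_on_disk rho f /\ is_finite (disk_sup rho f).

(** For [0 < rho], this is the supremum distance between functions bounded on
    the disk; [real] sends an infinite supremum to [0], so it is meaningful
    only on [bounded_analytic rho]. *)
Definition disk_dist (rho : R) (f g : C -> C) : R :=
  real (disk_sup rho (fun z => Cminus (f z) (g z))).

Section MetricEntropy.

Context {T : Type}.
(** [X] is the ambient space, to which the centers must belong, and [K] the
    subset to be covered. *)
Variables (d : T -> T -> R) (X K : T -> Prop).

Definition is_covering (eps : R) (centers : list T) : Prop :=
  List.Forall X centers /\
  forall x, K x -> exists c, In c centers /\ d x c <= eps.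

(** Lists may contain repetitions, or points at distance [0], but a covering
    of least length has none, so the least length is the least cardinality. *)
Definition is_covering_number (eps : R) (N : nat) : Prop :=
  (exists l, is_covering eps l /\ length l = N) /\
  (forall l, is_covering eps l -> (N <= length l)%nat).

(** In particular a finite covering exists. *)
Definition is_metric_entropy (eps h : R) : Prop :=
  exists N : nat, is_covering_number eps N /\ h = log2 (INR N).

End MetricEntropy.

(* Main.v *)
Require Import Defs.
From Stdlib Require Import ZArith Reals List Lra Lia Classical ClassicalEpsilon.
From Coquelicot Require Import Coquelicot.

Open Scope R_scope.

(** Put [q = r / r'].  On the disk of radius [r], a function of the class is
    within [eps / 2] of a polynomial in [z / r] with about
    [n = log (1 / eps) / log (r' / r)] coefficients, the [k]-th of which is at
    most [M q^k] (lemma [taylor_estimate]).  A grid of side [s] has about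
    [(M q^k / s)^2] points in the [k]-th disk of coefficients, and for [s = eps]
    the logarithm of the product of these numbers over [k < n] is the main term
    [log^2 (1 / eps) / log (r' / r)].  The second term is the price of comparing
    coefficients with suprema: changing [s] by a factor [c] changes the
    logarithm of the product by [2 n log c].  Adding up the moduli of [n]
    coefficients would give [c = n], hence [gamma] of modulus [2].  To have
    [gamma] of modulus [1] one needs [c] to be [sqrt n] up to powers of [log n],
    which is the size of a sum of [n] bounded terms that cancel like random
    signs.

    Such cancellation is provided by [balanced_Cpoly]: if each real
    coordinate of the [n] coefficients of a polynomial may be chosen between two
    values in [[-1, 0]] and [[0, 1]], some choice makes the polynomial at most
    [spread n], of order [sqrt n log n], on the unit disk.  It is used on both sides.
    For the upper bound ([covering_upper_bound]) the real coordinates of the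
    coefficients are rounded down or up to the grid of side [eps / (2 spread n)],
    and the errors are balanced.  For the lower bound ([covering_lower_bound])
    the coefficients of polynomials in [z / r'] run through a grid of points
    whose coordinates lie between [0] and [M / spread n], and signs are put on
    the coordinates so that the polynomial is in the class; the absolute values
    of the coordinates still tell which grid point it comes from, and Cauchy's
    estimates show that different grid points give distant polynomials.

    Analyticity is given by local power series, so Taylor's theorem on the whole
    disk has to be derived.  The maximum principle is obtained without integrals
    from second order Taylor polynomials; it yields a Schwarz lemma of every
    order, then Cauchy's estimates by averaging over roots of unity, then the
    remainder of the Taylor polynomial at [0]. *)

(** * Finite sums *)

Fixpoint Csum (f : nat -> C) (n : nat) : C :=
  match n with O => 0%C | S m => (Csum f m + f m)%C end.

Fixpoint Rsum (f : nat -> R) (n : nat) : R :=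
  match n with O => 0 | S m => Rsum f m + f m end.

Lemma Csum_ext (f g : nat -> C) n :
  (forall k, (k < n)%nat -> f k = g k) -> Csum f n = Csum g n.
Proof.
induction n as [|n IH]; intros H; simpl; [reflexivity|].
rewrite IH by (intros; apply H; lia). now rewrite H by lia.
Qed.

Lemma Csum_plus (f g : nat -> C) n : Csum (fun k => f k + g k)%C n = (Csum f n + Csum g n)%C.
Proof. induction n as [|n IH]; simpl; [ring|rewrite IH; ring]. Qed.

Lemma Csum_mult_l (c : C) (f : nat -> C) n : Csum (fun k => c * f k)%C n = (c * Csum f n)%C.
Proof. induction n as [|n IH]; simpl; [ring|rewrite IH; ring]. Qed.

Lemma Csum_minus (f g : nat -> C) n : Csum (fun k => f k - g k)%C n = (Csum f n - Csum g n)%C.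
Proof. induction n as [|n IH]; simpl; [ring|rewrite IH; ring]. Qed.

Lemma Csum_0 (f : nat -> C) n : (forall k, (k < n)%nat -> f k = 0%C) -> Csum f n = 0%C.
Proof.
induction n as [|n IH]; intros H; simpl; [reflexivity|].
rewrite IH by (intros; apply H; lia). rewrite H by lia. ring.
Qed.

Lemma Csum_shift (f : nat -> C) n : Csum f (S n) = (f O + Csum (fun k => f (S k)) n)%C.
Proof.
induction n as [|n IH]; simpl in *; [ring|]. rewrite IH. ring.
Qed.

Lemma Csum_add (f : nat -> C) n m :
  Csum f (n + m) = (Csum f n + Csum (fun k => f (n + k)%nat) m)%C.
Proof.
induction m as [|m IH]; simpl.
- rewrite Nat.add_0_r. ring.
- rewrite Nat.add_succ_r; simpl. rewrite IH. ring.
Qed.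

Lemma Rsum_le f g n :
  (forall k, (k < n)%nat -> f k <= g k) -> Rsum f n <= Rsum g n.
Proof.
induction n as [|n IH]; intros H; simpl; [lra|].
apply Rplus_le_compat; [apply IH; intros|]; apply H; lia.
Qed.

Lemma Rsum_mult_l c f n : Rsum (fun k => c * f k) n = c * Rsum f n.
Proof. induction n as [|n IH]; simpl; [ring|rewrite IH; ring]. Qed.

Lemma Rsum_const c n : Rsum (fun _ => c) n = INR n * c.
Proof. induction n as [|n IH]; [simpl; ring|]. rewrite S_INR; simpl; rewrite IH; ring. Qed.

Lemma Cmod_Csum_le (f : nat -> C) (g : nat -> R) n :
  (forall k, (k < n)%nat -> Cmod (f k) <= g k) -> Cmod (Csum f n) <= Rsum g n.
Proof.
induction n as [|n IH]; intros H; simpl; [rewrite Cmod_0; lra|].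
eapply Rle_trans; [apply Cmod_triangle|].
apply Rplus_le_compat; [apply IH; intros|]; apply H; lia.
Qed.

(** Bounding by [x / (1 - q)] instead of the exact value keeps the number of
    terms out of the estimates. *)
Lemma Rsum_geom_le x q n :
  0 <= x -> 0 <= q < 1 -> Rsum (fun k => x * q ^ k) n <= x / (1 - q).
Proof.
intros Hx Hq.
assert (E : Rsum (fun k => x * q ^ k) n = x * (1 - q ^ n) / (1 - q)).
{ induction n as [|n IH]; simpl; [field; lra|]. rewrite IH. field; lra. }
rewrite E. apply Rmult_le_compat_r; [left; apply Rinv_0_lt_compat; lra|].
assert (0 <= q ^ n) by (apply pow_le; lra). nra.
Qed.

Lemma Cmod_ge_minus (x y : C) : Cmod x - Cmod y <= Cmod (x + y)%C.
Proof.
assert (H := Cmod_triangle (x + y)%C (- y)%C).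
replace (x + y + - y)%C with x in H by ring. rewrite Cmod_opp in H. lra.
Qed.

Lemma Cmod_minus_sym (x y : C) : Cmod (x - y)%C = Cmod (y - x)%C.
Proof. rewrite <- Cmod_opp. f_equal. ring. Qed.

Lemma Cmod_le_Re_Im (x y : R) : Cmod (x, y) <= Rabs x + Rabs y.
Proof.
replace (x, y) with (RtoC x + RtoC y * Ci)%C
  by (unfold RtoC, Ci, Cplus, Cmult; simpl; f_equal; ring).
eapply Rle_trans; [apply Cmod_triangle|].
rewrite Cmod_mult, Cmod_Ci, !Cmod_R. lra.
Qed.

(** * Taylor polynomials at a point *)

(** Taylor expansion of [f] at [z0] with [n] terms and a remainder of order [n].
    Three terms are all that the maximum principle needs, and, unlike a local
    power series, a finite expansion is divided by a power of [z] by elementary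
    algebra. *)
Definition jet (n : nat) (f : C -> C) (z0 : C) (a : nat -> C) : Prop :=
  exists K delta : R, 0 < delta /\
    forall h : C, Cmod h < delta ->
      Cmod (f (z0 + h)%C - Csum (fun m => a m * h ^ m)%C n)%C <= K * Cmod h ^ n.

Lemma jet_bounds n f z0 a :
  jet n f z0 a -> exists K delta, 0 <= K /\ 0 < delta <= 1 /\
    forall h : C, Cmod h < delta ->
      Cmod (f (z0 + h)%C - Csum (fun m => a m * h ^ m)%C n)%C <= K * Cmod h ^ n.
Proof.
intros [K [d [Hd H]]]. exists (Rmax K 0), (Rmin d 1).
split; [apply Rmax_r|]. split.
{ split; [apply Rmin_glb_lt; lra|apply Rmin_r]. }
intros h Hh. eapply Rle_trans.
- apply H. eapply Rlt_le_trans; [apply Hh|apply Rmin_l].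
- apply Rmult_le_compat_r; [apply pow_le, Cmod_ge_0|apply Rmax_l].
Qed.

Lemma jet_ext n (f g : C -> C) z0 (a b : nat -> C) :
  (forall z, f z = g z) -> (forall m, (m < n)%nat -> a m = b m) ->
  jet n f z0 a -> jet n g z0 b.
Proof.
intros E E' [K [d [Hd H]]]. exists K, d; split; [easy|].
intros h Hh. rewrite <- E.
rewrite <- (Csum_ext (fun m => a m * h ^ m)%C) by (intros k Hk; now rewrite E').
now apply H.
Qed.

Lemma jet_plus n (f g : C -> C) z0 (a b : nat -> C) :
  jet n f z0 a -> jet n g z0 b ->
  jet n (fun z => f z + g z)%C z0 (fun m => a m + b m)%C.
Proof.
intros [K [d [Hd H]]] [K' [d' [Hd' H']]]. exists (K + K'), (Rmin d d').
split; [now apply Rmin_glb_lt|]. intros h Hh.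
rewrite (Csum_ext _ (fun m => a m * h ^ m + b m * h ^ m)%C) by (intros; ring).
rewrite Csum_plus.
specialize (H h (Rlt_le_trans _ _ _ Hh (Rmin_l _ _))).
specialize (H' h (Rlt_le_trans _ _ _ Hh (Rmin_r _ _))).
match goal with |- Cmod ?x <= _ =>
  replace x with ((f (z0 + h) - Csum (fun m => a m * h ^ m) n)
     + (g (z0 + h) - Csum (fun m => b m * h ^ m) n))%C by ring end.
eapply Rle_trans; [apply Cmod_triangle|]. lra.
Qed.

Lemma jet_scal n (f : C -> C) (z0 : C) (a : nat -> C) (c : C) :
  jet n f z0 a -> jet n (fun z => c * f z)%C z0 (fun m => c * a m)%C.
Proof.
intros [K [d [Hd H]]]. exists (Cmod c * K), d.
split; [easy|]. intros h Hh.
rewrite (Csum_ext _ (fun m => c * (a m * h ^ m))%C) by (intros; ring).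
rewrite Csum_mult_l.
match goal with |- Cmod ?x <= _ =>
  replace x with (c * (f (z0 + h) - Csum (fun m => a m * h ^ m) n))%C by ring end.
rewrite Cmod_mult, Rmult_assoc. apply Rmult_le_compat_l; [apply Cmod_ge_0|auto].
Qed.

Lemma jet_rotate n (f : C -> C) (z0 : C) (a : nat -> C) (w : C) :
  Cmod w = 1 -> jet n f (w * z0)%C a ->
  jet n (fun z => f (w * z)%C) z0 (fun m => w ^ m * a m)%C.
Proof.
intros Hw [K [d [Hd H]]]. exists K, d.
split; [easy|]. intros h Hh.
assert (E : Cmod (w * h) = Cmod h) by (rewrite Cmod_mult, Hw; ring).
specialize (H (w * h)%C). rewrite E in H. specialize (H Hh).
replace (w * (z0 + h))%C with (w * z0 + w * h)%C by ring.
rewrite (Csum_ext _ (fun m => a m * (w * h) ^ m)%C); [easy|].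
intros; rewrite Cpow_mult_l; ring.
Qed.

Lemma jet_zero n z0 : jet n (fun _ => 0%C) z0 (fun _ => 0%C).
Proof.
exists 0, 1; split; [lra|]. intros h _.
rewrite (Csum_0 _ n) by (intros; simpl; ring).
replace (RtoC 0 - RtoC 0)%C with (RtoC 0) by ring. rewrite Cmod_0; lra.
Qed.

Lemma jet_Csum n m (f : nat -> C -> C) z0 (a : nat -> nat -> C) :
  (forall j, jet n (f j) z0 (a j)) ->
  jet n (fun z => Csum (fun j => f j z) m) z0 (fun k => Csum (fun j => a j k) m).
Proof.
intros H; induction m as [|m IH]; simpl.
- apply jet_zero.
- now apply (jet_plus n (fun z => Csum (fun j => f j z) m)).
Qed.

Lemma jet_continuous n f z0 a :
  (0 < n)%nat -> jet n f z0 a -> f z0 = a O /\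
  forall e, 0 < e -> exists delta, 0 < delta /\
    forall h, Cmod h < delta -> Cmod (f (z0 + h)%C - f z0)%C < e.
Proof.
intros Hn J. destruct n as [|n]; [lia|].
destruct (jet_bounds _ _ _ _ J) as [K [d [HK [Hd H]]]].
assert (E0 : f z0 = a O).
{ assert (H0 := H 0%C). rewrite Cmod_0 in H0. specialize (H0 (proj1 Hd)).
  rewrite Csum_shift in H0.
  rewrite (Csum_0 _ n) in H0 by (intros; simpl; ring).
  simpl pow in H0. rewrite Rmult_0_l, Rmult_0_r in H0.
  assert (H1 := Cmod_eq_0 _ (Rle_antisym _ _ H0 (Cmod_ge_0 _))).
  replace (z0 + 0)%C with z0 in H1 by ring. simpl in H1.
  replace (f z0) with (f z0 - (a O * 1 + 0) + a O)%C by ring.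
  rewrite H1. ring. }
split; [easy|]. intros e He.
set (A := Rsum (fun k => Cmod (a (S k))) n).
assert (HA : 0 <= A).
{ unfold A. clear. induction n; simpl; [lra|].
  assert (H := Cmod_ge_0 (a (S n))). lra. }
set (Q := K + A + 1).
exists (Rmin d (e / Q)). split.
{ apply Rmin_glb_lt; [lra|]. apply Rdiv_lt_0_compat; unfold Q; lra. }
intros h Hh.
assert (h1 : Cmod h < d) by (eapply Rlt_le_trans; [apply Hh|apply Rmin_l]).
assert (h2 : Cmod h < e / Q) by (eapply Rlt_le_trans; [apply Hh|apply Rmin_r]).
assert (h0 := Cmod_ge_0 h).
specialize (H h h1). rewrite Csum_shift in H.
assert (B : Cmod (Csum (fun k => a (S k) * h ^ (S k))%C n) <= A * Cmod h).
{ unfold A. rewrite Rmult_comm, <- Rsum_mult_l. apply Cmod_Csum_le. intros k _.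
  rewrite Cmod_mult, Cmod_pow. simpl.
  assert (Cmod h ^ k <= 1).
  { rewrite <- (pow1 k). apply pow_incr. lra. }
  assert (0 <= Cmod h ^ k) by now apply pow_le.
  assert (0 <= Cmod (a (S k))) by apply Cmod_ge_0.
  rewrite (Rmult_comm (Cmod h) (Cmod (a _))). apply Rmult_le_compat_l; [easy|]. nra. }
assert (B' : K * Cmod h ^ S n <= K * Cmod h).
{ apply Rmult_le_compat_l; [easy|]. simpl.
  assert (Cmod h ^ n <= 1).
  { rewrite <- (pow1 n). apply pow_incr. lra. }
  assert (0 <= Cmod h ^ n) by now apply pow_le. nra. }
rewrite E0.
match type of H with Cmod ?x <= _ =>
 replace (f (z0 + h)%C - a O)%C with (x + Csum (fun k => a (S k) * h ^ (S k))%C n)%C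
   by (simpl; ring) end.
eapply Rle_lt_trans; [apply Cmod_triangle|].
apply Rle_lt_trans with (Q * Cmod h); [unfold Q; nra|].
apply Rmult_lt_reg_r with (/ Q); [apply Rinv_0_lt_compat; unfold Q; lra|].
replace (Q * Cmod h * / Q) with (Cmod h) by (field; unfold Q; lra). exact h2.
Qed.

(** Away from the origin the coefficients of the quotient solve a triangular
    system, and [1 / (z0 + h)] stays bounded, so the order of the remainder is
    kept. *)
Lemma jet_div_z (f : C -> C) (z0 : C) (a : nat -> C) :
  z0 <> 0%C -> jet 3 f z0 a ->
  exists b, jet 3 (fun z => f z / z)%C z0 b.
Proof.
intros Hz J.
destruct (jet_bounds _ _ _ _ J) as [K [d [HK [Hd H]]]].
assert (Pz := proj1 (Cmod_gt_0 z0) Hz).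
pose (d0 := (a 0%nat / z0)%C). pose (d1 := ((a 1%nat - d0) / z0)%C).
pose (d2 := ((a 2%nat - d1) / z0)%C).
exists (fun m => match m with 0 => d0 | 1 => d1 | _ => d2 end)%nat.
exists ((K + Cmod d2) * / (Cmod z0 / 2)), (Rmin d (Cmod z0 / 2)).
split; [apply Rmin_glb_lt; lra|]. intros h Hh.
assert (h1 : Cmod h < d) by (eapply Rlt_le_trans; [apply Hh|apply Rmin_l]).
assert (h2 : Cmod h < Cmod z0 / 2) by (eapply Rlt_le_trans; [apply Hh|apply Rmin_r]).
assert (B : Cmod z0 / 2 <= Cmod (z0 + h)).
{ assert (h3 := Cmod_ge_minus z0 h). lra. }
assert (Nz : (z0 + h)%C <> 0%C) by (apply Cmod_gt_0; lra).
specialize (H h h1). simpl Csum in *.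
match type of H with Cmod ?x <= _ =>
match goal with |- Cmod ?y <= _ =>
  replace y with ((x - d2 * h ^ 3) / (z0 + h))%C
   by (unfold d2, d1, d0; simpl; field; now split) end end.
rewrite Cmod_div by easy. unfold Rdiv at 1.
rewrite (Rmult_assoc (K + _)), (Rmult_comm (/ _) (_ ^ 3)), <- Rmult_assoc.
apply Rmult_le_compat; [apply Cmod_ge_0|left; apply Rinv_0_lt_compat; lra| |].
- unfold Cminus at 1. eapply Rle_trans; [apply Cmod_triangle|].
  rewrite Cmod_opp, Cmod_mult, Cmod_pow. lra.
- apply Rinv_le_contravar; lra.
Qed.

Lemma jet_div_pow k (f : C -> C) (z0 : C) (a : nat -> C) :
  z0 <> 0%C -> jet 3 f z0 a ->
  exists b, jet 3 (fun z => f z / z ^ k)%C z0 b.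
Proof.
intros Hz J. induction k as [|k [b Jb]].
- exists a. eapply jet_ext; [| |exact J]; [|easy]. intros z. change (z ^ 0)%C with (RtoC 1). field.
- destruct (jet_div_z _ _ _ Hz Jb) as [c [K [d [Hd Hc]]]].
  exists c, K, (Rmin d (Cmod z0)).
  assert (Pz := proj1 (Cmod_gt_0 z0) Hz).
  split; [now apply Rmin_glb_lt|]. intros h Hh.
  assert (h2 : Cmod h < Cmod z0) by (eapply Rlt_le_trans; [apply Hh|apply Rmin_r]).
  assert (Nz : (z0 + h)%C <> 0%C).
  { apply Cmod_gt_0. assert (h3 := Cmod_ge_minus z0 h). lra. }
  replace (f (z0 + h) / (z0 + h) ^ S k)%C with (f (z0 + h) / (z0 + h) ^ k / (z0 + h))%C.
  + apply Hc. eapply Rlt_le_trans; [apply Hh|apply Rmin_l].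
  + rewrite Cpow_S. field. split; [now apply Cpow_nz|easy].
Qed.

(** At the origin, division by [z ^ k] shifts the coefficients of a function
    that vanishes to order [k]; the quotient is completed by the first
    coefficient that survives. *)
Lemma jet_div_pow_origin k n (f : C -> C) (a : nat -> C) :
  (0 < n)%nat -> (forall m, (m < k)%nat -> a m = 0%C) -> jet (k + n) f 0%C a ->
  jet n (fun z => if Ceq_dec z 0%C then a k else f z / z ^ k)%C 0%C
      (fun m => a (k + m)%nat).
Proof.
intros Hn Ha [K [d [Hd H]]]. exists K, d; split; [easy|]. intros h Hh.
replace (0 + h)%C with h by ring.
destruct (Ceq_dec h 0%C) as [->|Nz].
- destruct n as [|n]; [lia|]. rewrite Csum_shift, Nat.add_0_r.
  rewrite (Csum_0 _ n) by (intros; simpl; ring). rewrite Cmod_0. simpl pow.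
  replace (a k - (a k * 0 ^ 0 + 0))%C with (RtoC 0) by (simpl; ring).
  rewrite Cmod_0. lra.
- specialize (H h Hh). replace (0 + h)%C with h in H by ring.
  rewrite Csum_add in H.
  rewrite (Csum_0 _ k) in H by (intros m Hm; rewrite Ha by easy; ring).
  rewrite (Csum_ext _ (fun m => h ^ k * (a (k + m)%nat * h ^ m))%C) in H
    by (intros; rewrite Cpow_add_r; ring).
  rewrite Csum_mult_l in H.
  assert (Nk := Cpow_nz _ k Nz).
  match goal with |- Cmod ?x <= _ => set (X := x) end.
  match type of H with Cmod ?y <= _ => replace y with (h ^ k * X)%C in H
    by (unfold X; field; easy) end.
  rewrite Cmod_mult, Cmod_pow, pow_add in H.
  apply Rmult_le_reg_l with (Cmod h ^ k); [apply pow_lt, Cmod_gt_0, Nz|].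
  lra.
Qed.

(** * The maximum principle *)

Lemma Cmod_sq_plus_ge (p e : C) :
  Cmod p ^ 2 - 2 * (Cmod p * Cmod e) <= Cmod (p + e)%C ^ 2.
Proof.
assert (H := Cmod_ge_minus p e). assert (H1 := Cmod_ge_0 p).
assert (H2 := Cmod_ge_0 e). assert (H3 := Cmod_ge_0 (p + e)).
assert (H4 := pow2_ge_0 (Cmod (p + e))).
destruct (Rle_lt_dec (Cmod e) (Cmod p)); nra.
Qed.

(** Averaging over the directions [1, i, -1, -i] cancels every cross term of
    [|c0 + c1 h + c2 h^2|^2] and of [|z0 + h|^2], so only positive terms are
    left: the quadratic perturbation makes the function strictly subharmonic,
    to second order, at every point. *)
Lemma no_local_max g z0 a eps eta :
  jet 3 g z0 a -> 0 < eps -> 0 < eta ->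
  exists h, Cmod h < eta /\
    Cmod (g z0) ^ 2 + eps * Cmod z0 ^ 2
      < Cmod (g (z0 + h)%C) ^ 2 + eps * Cmod (z0 + h)%C ^ 2.
Proof.
intros J He Heta.
destruct (jet_continuous 3 _ _ _ ltac:(lia) J) as [E0 _].
destruct (jet_bounds _ _ _ _ J) as [K [d [HK [Hd H]]]].
set (p := fun h => (a 0%nat + a 1%nat * h + a 2%nat * (h * h))%C).
set (P := Cmod (a 0%nat) + Cmod (a 1%nat) + Cmod (a 2%nat)).
assert (HP : 0 <= P).
{ unfold P. generalize (Cmod_ge_0 (a 0%nat)), (Cmod_ge_0 (a 1%nat)),
    (Cmod_ge_0 (a 2%nat)). lra. }
assert (HPK : 0 <= P * K) by now apply Rmult_le_pos.
set (s := Rmin (Rmin (d / 2) (eta / 2)) (eps / (2 * (P * K + 1)))).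
assert (s0 : 0 < s).
{ unfold s. repeat apply Rmin_glb_lt; try lra.
  apply Rdiv_lt_0_compat; lra. }
assert (s1 : s <= d / 2) by (unfold s; eapply Rle_trans; apply Rmin_l).
assert (s2 : s <= eta / 2)
  by (unfold s; eapply Rle_trans; [apply Rmin_l|apply Rmin_r]).
assert (s3 : 2 * (P * K) * s < eps).
{ assert (s <= eps / (2 * (P * K + 1))) by apply Rmin_r.
  apply Rle_lt_trans with (2 * (P * K) * (eps / (2 * (P * K + 1)))).
  - apply Rmult_le_compat_l; lra.
  - apply Rmult_lt_reg_r with (P * K + 1); [lra|].
    replace (2 * (P * K) * (eps / (2 * (P * K + 1))) * (P * K + 1))
      with (P * K * eps) by (field; lra). nra. }
assert (L : forall h, Cmod h = s ->
   Cmod (p h) ^ 2 - 2 * (P * K * s ^ 3) <= Cmod (g (z0 + h)%C) ^ 2).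
{ intros h Hs. specialize (H h ltac:(lra)). rewrite Hs in H.
  match type of H with Cmod ?x <= _ =>
    replace (g (z0 + h)%C) with (p h + x)%C by (unfold p; simpl; ring);
    set (e := x) in * end.
  eapply Rle_trans; [|apply Cmod_sq_plus_ge].
  assert (Cmod (p h) <= P).
  { unfold p, P. eapply Rle_trans; [apply Cmod_triangle|].
    eapply Rle_trans; [apply Rplus_le_compat_r, Cmod_triangle|].
    rewrite !Cmod_mult, Hs.
    generalize (Cmod_ge_0 (a 1%nat)), (Cmod_ge_0 (a 2%nat)). intros.
    assert (s * s <= 1) by nra. nra. }
  assert (Cmod (p h) * Cmod e <= P * (K * s ^ 3)).
  { apply Rmult_le_compat; auto using Cmod_ge_0. }
  lra. }
apply NNPP; intros N.
assert (N' : forall h, Cmod h = s ->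
  Cmod (p h) ^ 2 - 2 * (P * K * s ^ 3) + eps * Cmod (z0 + h)%C ^ 2
  <= Cmod (a 0%nat) ^ 2 + eps * Cmod z0 ^ 2).
{ intros h Hs. apply Rnot_lt_le; intros F. apply N. exists h.
  split; [lra|]. rewrite E0. specialize (L h Hs). lra. }
assert (M1 : Cmod (s, 0) = s).
{ change (s, 0) with (RtoC s). rewrite Cmod_R. apply Rabs_pos_eq; lra. }
assert (M2 : Cmod (0, s) = s).
{ replace (0, s) with (Ci * (s, 0))%C
    by (unfold Ci, Cmult; simpl; f_equal; ring).
  rewrite Cmod_mult, Cmod_Ci, M1. ring. }
assert (M3 : Cmod (- s, 0) = s).
{ rewrite <- M1 at 2. rewrite <- (Cmod_opp (s, 0)). unfold Copp; simpl.
  now rewrite Ropp_0. }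
assert (M4 : Cmod (0, - s) = s).
{ rewrite <- M2 at 2. rewrite <- (Cmod_opp (0, s)). unfold Copp; simpl.
  now rewrite Ropp_0. }
assert (I1 := N' _ M1). assert (I2 := N' _ M2).
assert (I3 := N' _ M3). assert (I4 := N' _ M4).
revert I1 I2 I3 I4.
unfold p. rewrite !Cmod2_alt.
assert (S4 : 0 <= (Re (a 1%nat) ^ 2 + Im (a 1%nat) ^ 2) * s ^ 2 +
   (Re (a 2%nat) ^ 2 + Im (a 2%nat) ^ 2) * s ^ 4).
{ assert (0 <= s ^ 2) by apply pow2_ge_0. assert (0 <= s ^ 4) by (apply pow_le; lra).
  apply Rplus_le_le_0_compat; (apply Rmult_le_pos; [|easy]);
  apply Rplus_le_le_0_compat; apply pow2_ge_0. }
revert S4. clear -s3 s0.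
(* the contradiction is the sum of the four inequalities *)
destruct (a 0%nat) as [x0 y0], (a 1%nat) as [x1 y1], (a 2%nat) as [x2 y2].
destruct z0 as [u v]. unfold Re, Im, Cplus, Cmult; simpl fst; simpl snd.
intros S4 I1 I2 I3 I4.
assert (Q : 0 < s ^ 2 * (eps - 2 * (P * K) * s)).
{ apply Rmult_lt_0_compat; [now apply pow_lt|lra]. }
nra.
Qed.

Lemma finite_no_max (D : C -> Prop) (v : C -> R) (w : C) (l : list C) :
  D w ->
  ~ (forall w, D w -> exists z, In z l /\ D z /\ v w < v z).
Proof.
intros Dw. induction l as [|a l IH]; intros H.
- destruct (H w Dw) as [z [[] _]].
- apply IH. intros x Dx. destruct (H x Dx) as [z [[->|I] [Dz Hz]]]; [|eauto].
  destruct (H z Dz) as [z' [[->|I] [Dz' Hz']]]; [lra|].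
  exists z'. split; [easy|]. split; [easy|lra].
Qed.

Lemma perturbation_usc g z0 a eps L :
  jet 3 g z0 a -> 0 <= eps ->
  Cmod (g z0) ^ 2 + eps * Cmod z0 ^ 2 < L ->
  exists delta, 0 < delta /\ forall w, Cmod (w - z0)%C < delta ->
    Cmod (g w) ^ 2 + eps * Cmod w ^ 2 < L.
Proof.
intros J He HL.
destruct (jet_continuous 3 _ _ _ ltac:(lia) J) as [_ HC].
set (A := Cmod (g z0)) in *. set (D := Cmod z0) in *.
assert (HA : 0 <= A) by apply Cmod_ge_0. assert (HD : 0 <= D) by apply Cmod_ge_0.
set (Q := 2 * A + 1 + eps * (2 * D + 1)).
assert (HQ : 0 < Q) by (unfold Q; nra).
set (gap := L - (A ^ 2 + eps * D ^ 2)).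
set (e := Rmin 1 (gap / Q)).
assert (e0 : 0 < e).
{ apply Rmin_glb_lt; [lra|]. apply Rdiv_lt_0_compat; unfold gap; lra. }
assert (e1 : e <= 1) by apply Rmin_l.
assert (e2 : e * Q <= gap).
{ apply Rle_trans with (gap / Q * Q); [|right; field; lra].
  apply Rmult_le_compat_r; [lra|apply Rmin_r]. }
destruct (HC e e0) as [d [Hd H]].
exists (Rmin d e). split; [now apply Rmin_glb_lt|]. intros w Hw.
specialize (H (w - z0)%C (Rlt_le_trans _ _ _ Hw (Rmin_l _ _))).
assert (H2 := Rlt_le_trans _ _ _ Hw (Rmin_r _ _)).
replace (z0 + (w - z0))%C with w in H by ring.
assert (B1 : Cmod (g w) < A + e).
{ replace (g w) with (g z0 + (g w - g z0))%C by ring.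
  eapply Rle_lt_trans; [apply Cmod_triangle|]. fold A. lra. }
assert (B2 : Cmod w < D + e).
{ replace w with (z0 + (w - z0))%C by ring.
  eapply Rle_lt_trans; [apply Cmod_triangle|]. fold D. lra. }
assert (B3 : Cmod (g w) ^ 2 < (A + e) ^ 2).
{ generalize (Cmod_ge_0 (g w)); intro. nra. }
assert (B4 : eps * Cmod w ^ 2 <= eps * (D + e) ^ 2).
{ apply Rmult_le_compat_l; [easy|]. apply pow_incr.
  split; [apply Cmod_ge_0|lra]. }
assert (B5 : (A + e) ^ 2 <= A ^ 2 + e * (2 * A + 1)) by nra.
assert (B6 : eps * (D + e) ^ 2 <= eps * (D ^ 2 + e * (2 * D + 1))).
{ apply Rmult_le_compat_l; [easy|nra]. }
unfold gap, Q in e2. lra.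
Qed.

(** If [|g|] exceeded [B] somewhere, then for a small [eps] the function
    [v = |g|^2 + eps |z|^2] would take a larger value inside the disk than on the
    circle; its maximum would be attained inside, against [no_local_max].
    Compactness is used through a finite subcover: if every point had a
    neighbourhood on which [v] is less than one of its values, finitely many of
    these values would exceed all values of [v], although the largest of them is
    one. *)
Lemma maximum_principle g rho B :
  0 < rho ->
  (forall z, Cmod z <= rho -> exists a, jet 3 g z a) ->
  (forall z, Cmod z = rho -> Cmod (g z) <= B) ->
  forall z, Cmod z <= rho -> Cmod (g z) <= B.
Proof.
intros Hrho J HB z1 Hz1. apply Rnot_lt_le; intros Hlt.
assert (HB0 : 0 <= B).
{ eapply Rle_trans; [apply Cmod_ge_0|]. apply (HB (RtoC rho)).
  rewrite Cmod_R. apply Rabs_pos_eq; lra. }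
set (eps := (Cmod (g z1) ^ 2 - B ^ 2) / 2 / rho ^ 2).
assert (Hr2 : 0 < rho ^ 2) by now apply pow_lt.
assert (He : 0 < eps).
{ apply Rdiv_lt_0_compat; [nra|easy]. }
assert (Heq : eps * rho ^ 2 = (Cmod (g z1) ^ 2 - B ^ 2) / 2).
{ unfold eps. field. lra. }
set (v := fun z => Cmod (g z) ^ 2 + eps * Cmod z ^ 2).
set (D := fun z => Cmod z <= rho).
(* every point has a neighbourhood on which [v] stays below one of its values *)
assert (Loc : forall z, exists p : posreal * C,
   D z -> D (snd p) /\
   forall w, D w -> Cmod (w - z)%C < 2 * fst p -> v w < v (snd p)).
{ intros z. destruct (classic (D z)) as [Dz|Nz].
  2: { exists (mkposreal 1 Rlt_0_1, z). tauto. }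
  destruct (J z Dz) as [a Ja].
  assert (exists z', D z' /\ v z < v z') as [z' [Dz' Hz']].
  { destruct (Rle_lt_or_eq_dec _ _ Dz) as [Hi|Hb].
    - destruct (no_local_max g z a eps (rho - Cmod z) Ja He ltac:(lra))
        as [h [Hh Hv]].
      exists (z + h)%C. split; [|exact Hv].
      unfold D. eapply Rle_trans; [apply Cmod_triangle|]. lra.
    - exists z1. split; [easy|]. unfold v. rewrite Hb, Heq.
      specialize (HB z Hb).
      assert (Cmod (g z) ^ 2 <= B ^ 2)
        by (generalize (Cmod_ge_0 (g z)); intro; nra).
      assert (0 <= eps * Cmod z1 ^ 2)
        by (apply Rmult_le_pos; [lra|apply pow2_ge_0]).
      nra. }
  destruct (perturbation_usc g z a eps (v z') Ja ltac:(lra) Hz')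
    as [d [Hd H]].
  assert (Hd2 : 0 < d / 2) by lra.
  exists (mkposreal _ Hd2, z'). intros _. split; [easy|].
  simpl. intros w _ Hw. apply H. lra. }
set (pick := fun z => proj1_sig (constructive_indefinite_description _ (Loc z))).
assert (Hpick : forall z, D z -> D (snd (pick z)) /\
   forall w, D w -> Cmod (w - z)%C < 2 * fst (pick z) -> v w < v (snd (pick z))).
{ intros z. exact (proj2_sig (constructive_indefinite_description _ (Loc z))). }
(* centres outside the disk get a radius that keeps them away from it *)
set (delta := fun t : Compactness.Tn 2 R =>
  let z : C := (fst t, fst (snd t)) in
  match Rle_lt_dec (Cmod z) rho with
  | left _ => fst (pick z)
  | right H => mkposreal ((Cmod z - rho) / 2) (ltac:(lra))
  end).
apply (compactness_list 2 (- rho, (- rho, tt)) (rho, (rho, tt)) delta).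
intros [l Hl].
apply (finite_no_max D v z1
  (map (fun t : Compactness.Tn 2 R => snd (pick (fst t, fst (snd t)))) l) Hz1).
intros w Dw.
assert (Hw := Rmax_Cmod w).
assert (W1 : Rabs (fst w) <= rho)
  by (eapply Rle_trans; [apply Rmax_l|]; eapply Rle_trans; [exact Hw|exact Dw]).
assert (W2 : Rabs (snd w) <= rho)
  by (eapply Rle_trans; [apply Rmax_r|]; eapply Rle_trans; [exact Hw|exact Dw]).
apply Rabs_le_between in W1. apply Rabs_le_between in W2.
destruct (Hl (fst w, (snd w, tt))) as [[x [y []]] [It [_ Hc]]].
{ simpl. tauto. }
simpl in Hc. destruct Hc as [C1 [C2 _]].
assert (Cl : Cmod (w - (x, y))%C < 2 * delta (x, (y, tt))).
{ destruct w as [w1 w2]. unfold Cminus, Cplus, Copp; simpl in *.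
  eapply Rle_lt_trans; [apply Cmod_le_Re_Im|].
  unfold Rminus in C1, C2. lra. }
clear C1 C2. unfold delta in Cl. simpl fst in Cl; simpl snd in Cl.
destruct (Rle_lt_dec (Cmod (x, y)) rho) as [Dz|Nz].
- destruct (Hpick (x, y) Dz) as [Ds Hs].
  exists (snd (pick (x, y))). split; [|auto].
  apply in_map_iff. exists (x, (y, tt)). auto.
- exfalso. simpl in Cl. rewrite Cmod_minus_sym in Cl.
  assert (H := Cmod_ge_minus (x, y) (- w)%C). rewrite Cmod_opp in H.
  unfold D in Dw. unfold Cminus in Cl. lra.
Qed.

(** A Schwarz lemma of order [k]: [g z / z ^ k] obeys the maximum principle. *)
Lemma schwarz g rho B k a :
  0 < rho ->
  (forall z, Cmod z <= rho -> exists b, jet 3 g z b) ->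
  jet (k + 3) g 0%C a -> (forall m, (m < k)%nat -> a m = 0%C) ->
  (forall z, Cmod z = rho -> Cmod (g z) <= B) ->
  Cmod (a k) * rho ^ k <= B /\
  forall z, Cmod z <= rho -> Cmod (g z) * rho ^ k <= B * Cmod z ^ k.
Proof.
intros Hrho J J0 Ha HB.
set (q := fun z => if Ceq_dec z 0%C then a k else (g z / z ^ k)%C).
assert (Pk : 0 < rho ^ k) by now apply pow_lt.
assert (Bq : forall z, Cmod z <= rho -> Cmod (q z) <= B / rho ^ k).
{ apply maximum_principle; [easy| |].
  - intros z Hz. destruct (Ceq_dec z 0%C) as [->|Nz].
    + eexists. apply jet_div_pow_origin; [lia|exact Ha|exact J0].
    + destruct (J z Hz) as [b Jb].
      destruct (jet_div_pow k g z b Nz Jb) as [c [K [d [Hd Hc]]]].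
      assert (Pz := proj1 (Cmod_gt_0 z) Nz).
      exists c, K, (Rmin d (Cmod z)). split; [now apply Rmin_glb_lt|].
      intros h Hh. unfold q. destruct (Ceq_dec (z + h) 0%C) as [E|_].
      * exfalso. assert (h2 := Rlt_le_trans _ _ _ Hh (Rmin_r _ _)).
        assert (h3 := Cmod_ge_minus z h). rewrite E, Cmod_0 in h3. lra.
      * apply Hc. eapply Rlt_le_trans; [apply Hh|apply Rmin_l].
  - intros z Hz. unfold q. destruct (Ceq_dec z 0%C) as [->|Nz].
    + rewrite Cmod_0 in Hz. lra.
    + rewrite Cmod_div, Cmod_pow, Hz by now apply Cpow_nz.
      apply Rmult_le_compat_r; [left; now apply Rinv_0_lt_compat|auto]. }
assert (X : forall z, Cmod z <= rho -> Cmod (q z) * rho ^ k <= B).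
{ intros z Hz. apply Rle_trans with (B / rho ^ k * rho ^ k).
  - apply Rmult_le_compat_r; [lra|auto].
  - right. field. lra. }
split.
- assert (H := X 0%C). unfold q in H. rewrite Cmod_0 in H.
  destruct (Ceq_dec 0 0%C) as [_|N]; [apply H; lra|easy].
- intros z Hz. destruct (Ceq_dec z 0%C) as [->|Nz].
  + assert (E : g 0%C = a O).
    { now apply (jet_continuous (k + 3)); [lia|]. }
    destruct k as [|k].
    * specialize (X 0%C). unfold q in X.
      destruct (Ceq_dec 0 0%C) as [_|N]; [|easy].
      rewrite E, Rmult_1_r. simpl pow in *. rewrite Cmod_0 in X. lra.
    * rewrite E, Ha, Cmod_0 by lia. simpl. lra.
  + specialize (X z Hz). unfold q in X.
    destruct (Ceq_dec z 0%C) as [E|_]; [easy|].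
    rewrite Cmod_div, Cmod_pow in X by now apply Cpow_nz.
    assert (Pz : 0 < Cmod z ^ k) by now apply pow_lt, Cmod_gt_0.
    apply Rmult_le_reg_r with (/ Cmod z ^ k); [now apply Rinv_0_lt_compat|].
    replace (B * Cmod z ^ k * / Cmod z ^ k) with B by (field; lra).
    unfold Rdiv in X. lra.
Qed.

(** * Cauchy's estimates and Taylor's theorem *)

Lemma sum_n_pseries (a : nat -> C) (h : C) n :
  sum_n (fun k => @scal C_AbsRing C_NormedModule (pow_n (h : C_AbsRing) k) (a k)) n
  = Csum (fun m => a m * h ^ m)%C (S n).
Proof.
assert (E : forall k, @scal C_AbsRing C_NormedModule (pow_n (h : C_AbsRing) k) (a k)
   = (a k * h ^ k)%C).
{ intros k. change (Cmult (pow_n (h : C_AbsRing) k) (a k) = (a k * h ^ k)%C).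
  apply Cmult_comm. }
induction n as [|n IH].
- rewrite sum_O, E. simpl. ring.
- rewrite sum_Sn, IH, E. reflexivity.
Qed.

Lemma is_pseries_Csum (a : nat -> C) (h l : C) :
  @is_pseries C_AbsRing C_NormedModule a h l ->
  forall e, 0 < e -> exists N, forall n, (N <= n)%nat ->
    Cmod (Csum (fun m => a m * h ^ m)%C n - l)%C < e.
Proof.
intros H e He. unfold is_pseries, is_series in H.
assert (H' := proj1 (filterlim_locally_ball_norm _ _) H (mkposreal e He)).
destruct H' as [N HN]. exists (S N). intros n Hn.
destruct n as [|n]; [lia|]. specialize (HN n ltac:(lia)).
unfold ball_norm in HN. rewrite sum_n_pseries in HN. exact HN.
Qed.

(** Comparison with a geometric series inside the disk of convergence. *)
Lemma pseries_jet (f : C -> C) (z0 : C) (a : nat -> C) delta n :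
  0 < delta ->
  (forall h, Cmod h < delta -> @is_pseries C_AbsRing C_NormedModule a h (f (z0 + h)%C)) ->
  jet n f z0 a.
Proof.
intros Hd H. set (rho := delta / 2).
assert (Hr : 0 < rho) by (unfold rho; lra).
assert (Mr : Cmod (RtoC rho) = rho) by (rewrite Cmod_R; apply Rabs_pos_eq; lra).
assert (exists B, 0 <= B /\ forall k, Cmod (a k) * rho ^ k <= B) as [B [HB0 HB]].
{ destruct (filterlim_bounded _ (ex_intro _ _ (H (RtoC rho) ltac:(rewrite Mr; unfold rho; lra))))
    as [M HM].
  assert (HM' : forall k, Cmod (Csum (fun m => a m * RtoC rho ^ m)%C k) <= M).
  { intros [|k].
    - simpl. rewrite Cmod_0. eapply Rle_trans; [|apply (HM O)].
      apply norm_ge_0.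
    - rewrite <- sum_n_pseries. apply (HM k). }
  exists (2 * M). split.
  - specialize (HM' O). simpl in HM'. rewrite Cmod_0 in HM'. lra.
  - intros k. rewrite <- Mr at 1. rewrite <- Cmod_pow, <- Cmod_mult.
    assert (H1 := HM' (S k)). assert (H2 := HM' k). simpl in H1.
    match type of H1 with Cmod (?x + ?y)%C <= _ =>
      replace y with ((x + y) + - x)%C by ring end.
    eapply Rle_trans; [apply Cmod_triangle|]. rewrite Cmod_opp. lra. }
exists (2 * B / rho ^ n), (rho / 2). split; [lra|]. intros h Hh.
assert (h0 := Cmod_ge_0 h). assert (Pn : 0 < rho ^ n) by now apply pow_lt.
set (t := Cmod h / rho).
assert (Ht : 0 <= t <= / 2).
{ unfold t. split; [apply Rdiv_le_0_compat; lra|].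
  apply Rmult_le_reg_r with rho; [easy|].
  replace (Cmod h / rho * rho) with (Cmod h) by (field; lra). lra. }
assert (Eh : Cmod h = t * rho) by (unfold t; field; lra).
apply le_epsilon. intros e He.
destruct (is_pseries_Csum _ _ _ (H h ltac:(unfold rho in *; lra)) e He) as [N HN].
specialize (HN (n + N)%nat ltac:(lia)). rewrite Csum_add in HN.
match type of HN with Cmod (?s + ?s' - ?l)%C < _ =>
  replace (l - s)%C with (s' - (s + s' - l))%C by ring;
  assert (HS : Cmod s' <= 2 * B * t ^ n) end.
{ eapply Rle_trans.
  - apply (Cmod_Csum_le _ (fun k => B * t ^ n * t ^ k)). intros k _.
    rewrite Cmod_mult, Cmod_pow, Eh, Rpow_mult_distr, pow_add.
    replace (Cmod (a (n + k)%nat) * (t ^ n * t ^ k * rho ^ (n + k)))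
      with (Cmod (a (n + k)%nat) * rho ^ (n + k) * (t ^ n * t ^ k)) by ring.
    rewrite (Rmult_assoc B). apply Rmult_le_compat_r; [|apply HB].
    apply Rmult_le_pos; apply pow_le; lra.
  - assert (0 <= B * t ^ n) by (apply Rmult_le_pos; [easy|apply pow_le; lra]).
    eapply Rle_trans; [apply Rsum_geom_le; lra|].
    apply Rmult_le_reg_r with (1 - t); [lra|].
    replace (B * t ^ n / (1 - t) * (1 - t)) with (B * t ^ n) by (field; lra).
    nra. }
unfold Cminus at 1. eapply Rle_trans; [apply Cmod_triangle|]. rewrite Cmod_opp.
replace (2 * B / rho ^ n * Cmod h ^ n) with (2 * B * t ^ n)
  by (rewrite Eh, Rpow_mult_distr; field; lra).
lra.
Qed.

Lemma analytic_jet rho f z :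
  analytic_on_disk rho f -> in_disk rho z -> exists a, forall n, jet n f z a.
Proof.
intros H Hz. destruct (H z Hz) as [a [d [Hd Ha]]]. exists a. intros n.
unfold in_disk in *.
apply pseries_jet with (Rmin d (rho - Cmod z)); [apply Rmin_glb_lt; lra|].
intros h Hh.
assert (h1 := Rlt_le_trans _ _ _ Hh (Rmin_l _ _)).
assert (h2 := Rlt_le_trans _ _ _ Hh (Rmin_r _ _)).
replace h with (z + h - z)%C at 1 by ring. apply Ha.
- eapply Rle_lt_trans; [apply Cmod_triangle|]. lra.
- now replace (z + h - z)%C with h by ring.
Qed.

Definition Cpoly (c : nat -> C) (n : nat) (z : C) : C :=
  Csum (fun k => c k * z ^ k)%C n.

(** Horner's scheme, applied to the expansion at [z0]. *)
Lemma Cpoly_recenter (c : nat -> C) n z0 :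
  exists b : nat -> C, (forall k, (n <= k)%nat -> b k = 0%C) /\
    forall h, Cpoly c n (z0 + h)%C = Cpoly b n h.
Proof.
revert c; induction n as [|n IH]; intros c.
- exists (fun _ => 0%C). now split.
- destruct (IH (fun k => c (S k))) as [b [Hb E]].
  exists (fun k => match k with
     | O => c O + z0 * b O | S j => z0 * b (S j) + b j end)%C.
  split.
  + intros [|k] Hk; [lia|]. rewrite !Hb by lia. ring.
  + intros h. unfold Cpoly in *. rewrite Csum_shift.
    rewrite (Csum_ext _ (fun k => (z0 + h) * (c (S k) * (z0 + h) ^ k))%C)
      by (intros; rewrite Cpow_S; ring).
    rewrite Csum_mult_l, E, Csum_shift.
    rewrite (Csum_ext (fun k => (z0 * b (S k) + b k) * h ^ S k)%C
       (fun k => z0 * (b (S k) * h ^ S k) + h * (b k * h ^ k))%C)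
      by (intros; rewrite Cpow_S; ring).
    rewrite Csum_plus, !Csum_mult_l.
    assert (Q := Csum_shift (fun k => b k * h ^ k)%C n). simpl Csum in Q at 1.
    rewrite Hb in Q by lia.
    replace (Csum (fun k => b k * h ^ k)%C n + 0 * h ^ n)%C
      with (Csum (fun k => b k * h ^ k)%C n) in Q by ring.
    set (X := Csum (fun k => b k * h ^ k)%C n) in *.
    set (Y := Csum (fun k => b (S k) * h ^ S k)%C n) in *.
    change (h ^ 0)%C with (RtoC 1) in *. change ((z0 + h) ^ 0)%C with (RtoC 1).
    replace Y with (X - b O)%C by (rewrite Q; ring). ring.
Qed.

Lemma Cpoly_analytic rho c n : analytic_on_disk rho (Cpoly c n).
Proof.
intros z0 _. destruct (Cpoly_recenter c n z0) as [b [Hb E]].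
exists b, 1. split; [lra|]. intros z _ _.
replace (Cpoly c n z) with (Cpoly b n (z - z0)%C)
  by (rewrite <- E; f_equal; ring).
unfold is_pseries, is_series. apply filterlim_ext_loc with (fun _ => Cpoly b n (z - z0)%C).
- exists n. intros m Hm. rewrite sum_n_pseries.
  replace (S m) with (n + (S m - n))%nat by lia. rewrite Csum_add.
  rewrite (Csum_0 _ (S m - n)); [unfold Cpoly; ring|].
  intros k _. rewrite Hb by lia. ring.
- apply filterlim_const.
Qed.

Lemma Cpoly_jet_origin c n N :
  jet N (Cpoly c n) 0%C (fun k => if Nat.ltb k n then c k else 0%C).
Proof.
set (b := fun k => if Nat.ltb k n then c k else 0%C).
apply pseries_jet with 1; [lra|]. intros h _.
replace (0 + h)%C with h by ring.
replace (Cpoly c n h) with (Cpoly b n h).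
2: { apply Csum_ext. intros k Hk. unfold b.
  now rewrite (proj2 (Nat.ltb_lt _ _) Hk). }
unfold is_pseries, is_series. apply filterlim_ext_loc with (fun _ => Cpoly b n h).
- exists n. intros m Hm. rewrite sum_n_pseries.
  replace (S m) with (n + (S m - n))%nat by lia. rewrite Csum_add.
  rewrite (Csum_0 _ (S m - n)); [unfold Cpoly; ring|].
  intros k _. unfold b. replace (Nat.ltb (n + k) n) with false; [ring|].
  symmetry. apply Nat.ltb_ge. lia.
- apply filterlim_const.
Qed.

Definition cis (t : R) : C := (cos t, sin t).

Lemma cis_pow t j : (cis t ^ j)%C = cis (INR j * t).
Proof.
induction j as [|j IH].
- simpl. unfold cis. now rewrite Rmult_0_l, cos_0, sin_0.
- rewrite Cpow_S, IH, S_INR, Rmult_plus_distr_r, Rmult_1_l, Rplus_comm.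
  unfold cis, Cmult; simpl. rewrite cos_plus, sin_plus.
  f_equal; ring.
Qed.

Lemma Cmod_cis t : Cmod (cis t) = 1.
Proof.
unfold Cmod, cis; simpl fst; simpl snd.
replace (cos t ^ 2 + sin t ^ 2) with 1; [apply sqrt_1|].
rewrite <- (sin2_cos2 t). unfold Rsqr. ring.
Qed.

Lemma cis_neq_1 t : 0 < t < 2 * PI -> cis t <> 1%C.
Proof.
intros Ht E. apply (f_equal fst) in E. unfold cis in E; simpl in E.
replace t with (2 * (t / 2)) in E by field. rewrite cos_2a_sin in E.
assert (0 < sin (t / 2)) by (apply sin_gt_0; lra). nra.
Qed.

Lemma Csum_root_of_unity (z : C) n :
  (z ^ n)%C = 1%C -> z <> 1%C -> Csum (fun j => z ^ j)%C n = 0%C.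
Proof.
intros E N.
assert (G : forall m, ((z - 1) * Csum (fun j => z ^ j) m)%C = (z ^ m - 1)%C).
{ induction m as [|m IH]; simpl Csum; [simpl; ring|].
  rewrite Cpow_S. replace ((z - 1) * (Csum (fun j => z ^ j) m + z ^ m))%C
    with ((z - 1) * Csum (fun j => z ^ j) m + (z - 1) * z ^ m)%C by ring.
  rewrite IH. ring. }
specialize (G n). rewrite E in G.
assert (Nz : (z - 1)%C <> 0%C).
{ intros F. apply N. replace z with (z - 1 + 1)%C by ring. rewrite F. ring. }
replace (Csum (fun j => z ^ j) n)%C
  with ((z - 1) * Csum (fun j => z ^ j) n / (z - 1))%C by (field; easy).
rewrite G. field. easy.
Qed.

Lemma jet_Csum_ex n m (f : nat -> C -> C) z0 :
  (forall j, exists a, jet n (f j) z0 a) ->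
  exists a, jet n (fun z => Csum (fun j => f j z) m) z0 a.
Proof.
intros H. eexists. apply jet_Csum. intros j.
exact (proj2_sig (constructive_indefinite_description _ (H j))).
Qed.

Lemma pow_le_limit A k R0 M :
  0 < R0 -> (forall rho, 0 < rho < R0 -> A * rho ^ k <= M) -> A * R0 ^ k <= M.
Proof.
intros HR H. apply Rnot_lt_le. intros F.
assert (Cn : continuity_pt (fun x => A * x ^ k) R0) by reg.
destruct (Cn (A * R0 ^ k - M) ltac:(lra)) as [al [Hal Hc]].
set (rho := R0 - Rmin (al / 2) (R0 / 2)).
assert (m0 : 0 < Rmin (al / 2) (R0 / 2)) by (apply Rmin_glb_lt; lra).
assert (m1 := Rmin_l (al / 2) (R0 / 2)). assert (m2 := Rmin_r (al / 2) (R0 / 2)).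
specialize (H rho ltac:(unfold rho; lra)).
specialize (Hc rho). simpl in Hc. unfold R_dist in Hc.
assert (Q : Rabs (A * rho ^ k - A * R0 ^ k) < A * R0 ^ k - M).
{ apply Hc. split.
  - split; [exact I|unfold rho; lra].
  - unfold rho. rewrite Rabs_left; lra. }
apply Rabs_lt_between in Q. lra.
Qed.

(** The mean of [w^(-jk) f(w^j z)] over the powers of a primitive root of unity
    [w] of order [k + 1] kills the coefficients below the [k]-th, keeps the
    [k]-th one and does not exceed the supremum of [f]; the Schwarz lemma of
    order [k] then bounds that coefficient. *)
Lemma cauchy_estimate f R0 M (a : nat -> C) k :
  0 < R0 ->
  (forall z, Cmod z < R0 -> exists b, jet 3 f z b) ->
  jet (k + 3) f 0%C a ->
  (forall z, Cmod z < R0 -> Cmod (f z) <= M) ->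
  Cmod (a k) * R0 ^ k <= M.
Proof.
intros HR J J0 HM. apply pow_le_limit; [easy|]. intros rho Hrho.
set (n := S k). assert (n0 : 0 < INR n) by (unfold n; apply lt_0_INR; lia).
set (t := 2 * PI / INR n). set (w := cis t). set (wb := cis (- t)).
assert (Ww : (wb * w)%C = 1%C).
{ unfold wb, w, cis, Cmult; simpl. rewrite cos_neg, sin_neg.
  unfold RtoC. f_equal; [|ring]. rewrite <- (sin2_cos2 t). unfold Rsqr. ring. }
assert (Hwj : forall j, Cmod (w ^ j)%C = 1).
{ intros j. rewrite Cmod_pow. unfold w. rewrite Cmod_cis. apply pow1. }
set (c := fun j => ((wb ^ k) ^ j / INR n)%C).
set (F := fun z => Csum (fun j => c j * f (w ^ j * z))%C n).
set (b := fun m => Csum (fun j => c j * ((w ^ j) ^ m * a m))%C n).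
assert (Nn : RtoC (INR n) <> 0%C).
{ intros E. apply RtoC_inj in E. lra. }
assert (Eb : forall m, b m = (a m / INR n * Csum (fun j => (wb ^ k * w ^ m) ^ j) n)%C).
{ intros m. unfold b. rewrite <- Csum_mult_l. apply Csum_ext. intros j _.
  unfold c. rewrite Cpow_mult_l, <- !Cpow_mult_r, (Nat.mul_comm j m). field. easy. }
assert (Hjk : forall m, (m < k)%nat -> b m = 0%C).
{ intros m Hm. rewrite Eb.
  assert (Ez : (wb ^ k * w ^ m)%C = cis (INR (k - m) * - t)).
  { replace k with ((k - m) + m)%nat at 1 by lia.
    rewrite Cpow_add_r. replace (wb ^ (k - m) * wb ^ m * w ^ m)%C
      with (wb ^ (k - m) * (wb * w) ^ m)%C by (rewrite Cpow_mult_l; ring).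
    rewrite Ww, Cpow_1_l. unfold wb. rewrite cis_pow. ring. }
  rewrite Csum_root_of_unity; [ring| |].
  - rewrite Ez, cis_pow.
    replace (INR n * (INR (k - m) * - t)) with (- (0 + 2 * INR (k - m) * PI))
      by (unfold t; field; lra).
    unfold cis. rewrite cos_neg, sin_neg, cos_period, sin_period, cos_0, sin_0.
    now rewrite Ropp_0.
  - rewrite Ez. intros E. apply (cis_neq_1 (INR (k - m) * t)).
    + assert (0 < INR (k - m)) by (apply lt_0_INR; lia).
      assert (INR (k - m) < INR n) by (apply lt_INR; unfold n; lia).
      assert (P := PI_RGT_0). unfold t. split.
      * apply Rmult_lt_0_compat; [easy|]. apply Rdiv_lt_0_compat; lra.
      * replace (INR (k - m) * (2 * PI / INR n))
          with (2 * PI * (INR (k - m) / INR n)) by (field; lra).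
        rewrite <- (Rmult_1_r (2 * PI)) at 2.
        apply Rmult_lt_compat_l; [lra|].
        apply Rmult_lt_reg_r with (INR n); [easy|].
        replace (INR (k - m) / INR n * INR n) with (INR (k - m)) by (field; lra). lra.
    + unfold cis in *. rewrite Ropp_mult_distr_r_reverse, cos_neg, sin_neg in E.
      apply pair_equal_spec in E. destruct E as [E1 E2].
      unfold RtoC. f_equal; lra. }
assert (Hk : b k = a k).
{ rewrite Eb. rewrite (Csum_ext _ (fun _ => 1%C)).
  2: { intros j _. rewrite <- Cpow_mult_l, Ww. now rewrite !Cpow_1_l. }
  replace (Csum (fun _ => 1%C) n) with (RtoC (INR n)); [field; easy|].
  generalize n. clear. induction n as [|n IH]; [reflexivity|].
  rewrite S_INR, RtoC_plus, IH. reflexivity. }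
rewrite <- Hk.
apply (schwarz F rho M k b); [lra| | |exact Hjk|].
- intros z Hz. apply (jet_Csum_ex 3 n (fun j z => c j * f (w ^ j * z))%C).
  intros j. destruct (J (w ^ j * z)%C) as [d Jd].
  + rewrite Cmod_mult, Hwj. lra.
  + eexists. apply jet_scal, jet_rotate; [apply Hwj|exact Jd].
- apply (jet_Csum (k + 3) n (fun j z => c j * f (w ^ j * z))%C 0%C
    (fun j m => c j * ((w ^ j) ^ m * a m))%C).
  intros j. apply jet_scal, jet_rotate; [apply Hwj|].
  now replace (w ^ j * 0)%C with (RtoC 0) by ring.
- intros z Hz. unfold F. eapply Rle_trans.
  + apply (Cmod_Csum_le _ (fun _ => / INR n * M)). intros j _.
    unfold c. rewrite Cmod_mult, Cmod_div, !Cmod_pow by easy.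
    unfold wb. rewrite Cmod_cis, !pow1, Cmod_R, Rabs_pos_eq by lra.
    unfold Rdiv. rewrite Rmult_1_l. apply Rmult_le_compat_l.
    * left. now apply Rinv_0_lt_compat.
    * apply HM. rewrite Cmod_mult, Hwj. lra.
  + rewrite Rsum_const. right. field. lra.
Qed.

(** The crude bound of the first step, which comes from the Schwarz lemma on an
    intermediate circle, is only used to know that the Taylor polynomials
    converge; summing Cauchy's estimates then gives the sharp remainder. *)
Lemma taylor_estimate f r R0 M :
  0 < r < R0 -> analytic_on_disk R0 f ->
  (forall z, Cmod z < R0 -> Cmod (f z) <= M) ->
  exists a : nat -> C, (forall k, Cmod (a k) * R0 ^ k <= M) /\
    forall n z, Cmod z < r ->
      Cmod (f z - Cpoly a n z)%C <= M * (r / R0) ^ n / (1 - r / R0).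
Proof.
intros Hr A HM.
destruct (analytic_jet R0 f 0%C A) as [a Ja]; [unfold in_disk; rewrite Cmod_0; lra|].
assert (J : forall z, Cmod z < R0 -> exists b, jet 3 f z b).
{ intros z Hz. destruct (analytic_jet R0 f z A Hz) as [b Jb]. now exists b. }
assert (Ca : forall k, Cmod (a k) * R0 ^ k <= M).
{ intros k. apply (cauchy_estimate f); [lra|exact J|apply Ja|exact HM]. }
exists a. split; [exact Ca|].
assert (HM0 : 0 <= M).
{ eapply Rle_trans; [apply Cmod_ge_0|]. apply (HM 0%C). rewrite Cmod_0; lra. }
assert (T : forall rho k, 0 <= rho -> Cmod (a k) * rho ^ k <= M * (rho / R0) ^ k).
{ intros rho k H0. unfold Rdiv. rewrite Rpow_mult_distr, pow_inv.
  assert (0 < R0 ^ k) by (apply pow_lt; lra).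
  apply Rmult_le_reg_r with (R0 ^ k); [easy|].
  replace (M * (rho ^ k * / R0 ^ k) * R0 ^ k) with (M * rho ^ k) by (field; lra).
  assert (0 <= rho ^ k) by now apply pow_le. specialize (Ca k). nra. }
assert (Hq : 0 <= r / R0 < 1).
{ split; [apply Rdiv_le_0_compat; lra|].
  apply Rmult_lt_reg_r with R0; [lra|].
  replace (r / R0 * R0) with r by (field; lra). lra. }
set (rho := (r + R0) / 2). assert (Hrho : r < rho < R0) by (unfold rho; lra).
assert (Hp : 0 <= rho / R0 < 1).
{ split; [apply Rdiv_le_0_compat; lra|].
  apply Rmult_lt_reg_r with R0; [lra|].
  replace (rho / R0 * R0) with rho by (field; lra). lra. }
set (B := M + M / (1 - rho / R0)).
assert (HB0 : 0 <= B).
{ unfold B. apply Rplus_le_le_0_compat; [easy|]. apply Rdiv_le_0_compat; lra. }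
assert (Crude : forall n z, Cmod z < r -> Cmod (f z - Cpoly a n z)%C <= B * (r / rho) ^ n).
{ intros n z Hz.
  destruct (schwarz (fun z => f z + (-1) * Cpoly a n z)%C rho B n
     (fun m => a m + (-1) * (if Nat.ltb m n then a m else 0))%C) as [_ S].
  - lra.
  - intros y Hy. destruct (J y ltac:(lra)) as [b Jb].
    destruct (analytic_jet (rho + 1) (Cpoly a n) y (Cpoly_analytic _ _ _)) as [b' Jb'].
    { unfold in_disk; lra. }
    eexists. apply jet_plus; [exact Jb|]. apply jet_scal, Jb'.
  - apply jet_plus; [apply Ja|]. apply jet_scal, Cpoly_jet_origin.
  - intros m Hm. rewrite (proj2 (Nat.ltb_lt _ _) Hm). ring.
  - intros y Hy. eapply Rle_trans; [apply Cmod_triangle|].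
    apply Rplus_le_compat; [apply HM; lra|].
    rewrite Cmod_mult, (Cmod_R (-1)), (Rabs_left (-1)) by lra.
    replace (- -1) with 1 by ring. rewrite Rmult_1_l.
    eapply Rle_trans.
    + apply (Cmod_Csum_le _ (fun k => M * (rho / R0) ^ k)). intros k _.
      rewrite Cmod_mult, Cmod_pow, Hy. apply T. lra.
    + now apply Rsum_geom_le.
  - specialize (S z ltac:(lra)).
    replace (f z - Cpoly a n z)%C with (f z + -1 * Cpoly a n z)%C by ring.
    assert (0 < rho ^ n) by (apply pow_lt; lra).
    apply Rmult_le_reg_r with (rho ^ n); [easy|].
    eapply Rle_trans; [exact S|]. unfold Rdiv. rewrite Rpow_mult_distr, pow_inv.
    replace (B * (r ^ n * / rho ^ n) * rho ^ n) with (B * r ^ n) by (field; lra).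
    apply Rmult_le_compat_l; [easy|]. apply pow_incr.
    split; [apply Cmod_ge_0|lra]. }
intros n z Hz. apply le_epsilon. intros e He.
assert (Hs : Rabs (r / rho) < 1).
{ rewrite Rabs_pos_eq by (apply Rdiv_le_0_compat; lra).
  apply Rmult_lt_reg_r with rho; [lra|].
  replace (r / rho * rho) with r by (field; lra). lra. }
destruct (pow_lt_1_zero _ Hs (e / (B + 1)) ltac:(apply Rdiv_lt_0_compat; lra))
  as [N HN].
specialize (HN (n + N)%nat ltac:(lia)).
specialize (Crude (n + N)%nat z Hz).
assert (HT : Cmod (Cpoly a (n + N) z - Cpoly a n z)%C <= M * (r / R0) ^ n / (1 - r / R0)).
{ unfold Cpoly. rewrite Csum_add.
  match goal with |- Cmod (?x + ?y - ?x)%C <= _ =>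
    replace (x + y - x)%C with y by ring end.
  eapply Rle_trans.
  - apply (Cmod_Csum_le _ (fun k => M * (r / R0) ^ n * (r / R0) ^ k)). intros k _.
    rewrite Cmod_mult, Cmod_pow, Rmult_assoc, <- pow_add.
    eapply Rle_trans; [|apply T; lra]. apply Rmult_le_compat_l; [apply Cmod_ge_0|].
    apply pow_incr. split; [apply Cmod_ge_0|lra].
  - apply Rsum_geom_le; [|easy]. apply Rmult_le_pos; [easy|apply pow_le; lra]. }
replace (f z - Cpoly a n z)%C
  with ((Cpoly a (n + N) z - Cpoly a n z) + (f z - Cpoly a (n + N) z))%C by ring.
eapply Rle_trans; [apply Cmod_triangle|]. apply Rplus_le_compat; [easy|].
eapply Rle_trans; [exact Crude|].
assert (0 <= (r / rho) ^ (n + N)) by (apply pow_le, Rdiv_le_0_compat; lra).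
rewrite Rabs_pos_eq in HN by easy.
apply Rle_trans with ((B + 1) * (e / (B + 1))); [|right; field; lra].
apply Rmult_le_compat; lra.
Qed.

(** * Balancing: choosing signs and roundings that cancel *)

Definition lsum {A : Type} (F : A -> R) (l : list A) : R :=
  fold_right (fun c s => F c + s) 0 l.

Lemma lsum_ext {A : Type} (F G : A -> R) l :
  (forall c, F c = G c) -> lsum F l = lsum G l.
Proof. intros H; induction l as [|c l IH]; simpl; [reflexivity|]. now rewrite H, IH. Qed.

Lemma lsum_const {A : Type} (x : R) (l : list A) :
  lsum (fun _ => x) l = INR (length l) * x.
Proof.
induction l as [|c l IH]; [simpl; ring|].
change (length (c :: l)) with (S (length l)). rewrite S_INR. simpl. rewrite IH. ring.
Qed.

Lemma le_lsum {A : Type} (F : A -> R) l c :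
  (forall c, 0 <= F c) -> In c l -> F c <= lsum F l.
Proof.
intros HF; induction l as [|d l IH]; [intros []|].
assert (0 <= lsum F l).
{ clear IH. induction l as [|x l IH]; simpl; [lra|]. specialize (HF x). lra. }
simpl. intros [->|I]; [lra|]. specialize (IH I). specialize (HF d). lra.
Qed.

Lemma exp_le_quad x : Rabs x <= / 2 -> exp x <= 1 + x + 2 * x ^ 2.
Proof.
intros H. apply Rabs_le_between in H.
assert (E := exp_ineq1_le (- x)). rewrite exp_Ropp in E.
assert (P := exp_pos x).
assert (B : exp x * (1 - x) <= 1).
{ apply Rmult_le_reg_r with (/ exp x); [now apply Rinv_0_lt_compat|].
  replace (exp x * (1 - x) * / exp x) with (1 - x) by (field; lra). lra. }
assert (exp x * (1 - x) <= (1 + x + 2 * x ^ 2) * (1 - x)) by nra.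
nra.
Qed.

Lemma exp_pow x n : exp x ^ n = exp (INR n * x).
Proof.
induction n as [|n IH]; [simpl; now rewrite Rmult_0_l, exp_0|].
rewrite S_INR, Rmult_plus_distr_r, Rmult_1_l, exp_plus, <- IH. simpl; ring.
Qed.

(** The random variable equal to [a] with probability [b / (b - a)] and to [b]
    otherwise has mean [0], so on average it multiplies the potential by at most
    [1 + 2 t^2], and one of its two values does no worse. *)
Lemma balance_step {A : Type} (l : list A) (W g : A -> R) t a b :
  (forall c, 0 <= W c) -> (forall c, In c l -> Rabs (g c) <= 1) -> 0 <= t <= / 2 ->
  -1 <= a <= 0 -> 0 <= b <= 1 ->
  exists e, (e = a \/ e = b) /\
    lsum (fun c => W c * exp (t * (g c * e))) l <= (1 + 2 * t ^ 2) * lsum W l.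
Proof.
intros HW Hg Ht Ha Hb.
assert (Pt : 0 <= t ^ 2) by apply pow2_ge_0.
assert (HE : forall c e, In c l -> -1 <= e <= 1 ->
   exp (t * (g c * e)) <= 1 + t * (g c * e) + 2 * t ^ 2).
{ intros c e Ic He. specialize (Hg c Ic). apply Rabs_le_between in Hg.
  assert (Hge : -1 <= g c * e <= 1) by nra.
  eapply Rle_trans; [apply exp_le_quad|].
  - apply Rabs_le_between. nra.
  - rewrite Rpow_mult_distr.
    assert ((g c * e) ^ 2 <= 1) by nra. nra. }
assert (Avg : b * lsum (fun c => W c * exp (t * (g c * a))) l
   + - a * lsum (fun c => W c * exp (t * (g c * b))) l
   <= (b - a) * ((1 + 2 * t ^ 2) * lsum W l)).
{ clear Hg. induction l as [|c l IH]; simpl; [lra|].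
  assert (IH' := IH (fun c e I => HE c e (or_intror I))). clear IH.
  assert (E1 := HE c a (or_introl eq_refl) ltac:(lra)).
  assert (E2 := HE c b (or_introl eq_refl) ltac:(lra)).
  set (X := exp (t * (g c * a))) in *. set (Y := exp (t * (g c * b))) in *.
  specialize (HW c).
  assert (b * X + - a * Y <= (b - a) * (1 + 2 * t ^ 2)).
  { apply Rle_trans with (b * (1 + t * (g c * a) + 2 * t ^ 2)
      + - a * (1 + t * (g c * b) + 2 * t ^ 2)); [|right; ring].
    apply Rplus_le_compat; apply Rmult_le_compat_l; lra. }
  assert (W c * (b * X + - a * Y) <= W c * ((b - a) * (1 + 2 * t ^ 2)))
    by now apply Rmult_le_compat_l.
  lra. }
destruct (Req_dec b 0) as [Zb|Nb]; [destruct (Req_dec a 0) as [Za|Na]|].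
- exists a. split; [now left|]. rewrite Za.
  rewrite (lsum_ext _ W).
  2: { intros c. rewrite !Rmult_0_r, exp_0. ring. }
  assert (0 <= lsum W l).
  { clear -HW. induction l; simpl; [lra|]. specialize (HW a). lra. }
  nra.
- exists b. split; [now right|]. nra.
- destruct (Rle_lt_dec (lsum (fun c => W c * exp (t * (g c * a))) l)
     ((1 + 2 * t ^ 2) * lsum W l)) as [L|G1]; [exists a; tauto|].
  exists b. split; [now right|]. apply Rnot_lt_le. intros G2. nra.
Qed.

(** [e] is a corner of the rectangle with opposite corners [a] and [b]. *)
Definition corner (a b e : C) : Prop :=
  (Re e = Re a \/ Re e = Re b) /\ (Im e = Im a \/ Im e = Im b).

Definition around_0 (a b : C) : Prop :=
  (-1 <= Re a <= 0 /\ -1 <= Im a <= 0) /\ (0 <= Re b <= 1 /\ 0 <= Im b <= 1).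

Lemma corner_Cmod_le_2 a b e : around_0 a b -> corner a b e -> Cmod e <= 2.
Proof.
intros [[Ha Ha'] [Hb Hb']] [H1 H2]. destruct e as [x y].
eapply Rle_trans; [apply Cmod_le_Re_Im|]. simpl in *.
assert (Rabs x <= 1) by (apply Rabs_le_between; destruct H1; lra).
assert (Rabs y <= 1) by (apply Rabs_le_between; destruct H2; lra).
lra.
Qed.

Lemma Im_le_Cmod (c : C) : Rabs (Im c) <= Cmod c.
Proof. eapply Rle_trans; [apply Rmax_r|apply Rmax_Cmod]. Qed.

(** The method of conditional expectations: the exponential potential of a
    family of linear forms stays under control when the corners are chosen one
    after the other. *)
Lemma balance {A : Type} (l : list A) (g : A -> nat -> C) t (a b : nat -> C) n :
  (forall c k, In c l -> Cmod (g c k) <= 1) -> 0 <= t <= / 2 ->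
  (forall k, around_0 (a k) (b k)) ->
  exists e : nat -> C, (forall k, corner (a k) (b k) (e k)) /\
    lsum (fun c => exp (t * Re (Csum (fun k => g c k * e k)%C n))) l
      <= (1 + 2 * t ^ 2) ^ (2 * n) * INR (length l).
Proof.
intros Hg Ht Hab. induction n as [|n [e [He IH]]].
- exists a. split; [intros k; split; now left|]. simpl.
  rewrite (lsum_ext _ (fun _ => 1)) by (intros; now rewrite Rmult_0_r, exp_0).
  rewrite lsum_const. lra.
- destruct (Hab n) as [[Ha Ha'] [Hb Hb']].
  set (W := fun c => exp (t * Re (Csum (fun k => g c k * e k)%C n))) in *.
  destruct (balance_step l W (fun c => Re (g c n)) t (Re (a n)) (Re (b n)))
    as [x [Hx Bx]]; try easy.
  { intros c. left. apply exp_pos. }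
  { intros c Ic. eapply Rle_trans; [apply re_le_Cmod|auto]. }
  destruct (balance_step l (fun c => W c * exp (t * (Re (g c n) * x)))
    (fun c => - Im (g c n)) t (Im (a n)) (Im (b n))) as [y [Hy By]]; try easy.
  { intros c. apply Rmult_le_pos; left; apply exp_pos. }
  { intros c Ic. rewrite Rabs_Ropp. eapply Rle_trans; [apply Im_le_Cmod|auto]. }
  exists (fun k => if Nat.eqb k n then (x, y) else e k). split.
  { intros k. destruct (Nat.eqb_spec k n) as [->|_]; [|auto]. now split. }
  rewrite (lsum_ext _ (fun c => W c * exp (t * (Re (g c n) * x))
     * exp (t * (- Im (g c n) * y)))).
  + eapply Rle_trans; [exact By|].
    replace (2 * S n)%nat with (S (S (2 * n))) by lia. simpl pow at 2.
    assert (P : 0 <= 1 + 2 * t ^ 2) by (generalize (pow2_ge_0 t); lra).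
    rewrite !Rmult_assoc. apply Rmult_le_compat_l; [easy|].
    eapply Rle_trans; [exact Bx|]. apply Rmult_le_compat_l; easy.
  + intros c. unfold W. rewrite <- !exp_plus. f_equal. simpl Csum.
    rewrite Nat.eqb_refl.
    rewrite (Csum_ext _ (fun k => g c k * e k)%C).
    2: { intros k Hk. destruct (Nat.eqb_spec k n); [lia|reflexivity]. }
    destruct (Csum (fun k => g c k * e k)%C n), (g c n); simpl. ring.
Qed.

Lemma grid_truncation m x :
  (0 < m)%nat -> -1 <= x <= 1 ->
  exists j, (j < 2 * m + 1)%nat /\
    Rabs ((INR j - INR m) / INR m) <= Rabs x /\
    Rabs (x - (INR j - INR m) / INR m) <= / INR m.
Proof.
intros Hm Hx. assert (Pm : 0 < INR m) by now apply lt_0_INR.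
assert (Key : forall y, 0 <= y <= 1 -> exists k, (k <= m)%nat /\
   INR k / INR m <= y /\ y - INR k / INR m <= / INR m).
{ intros y Hy. destruct (nfloor_ex (INR m * y)) as [k Hk]; [nra|].
  exists k. split; [apply INR_le; nra|].
  split; apply Rmult_le_reg_l with (INR m); try easy.
  - replace (INR m * (INR k / INR m)) with (INR k) by (field; lra). lra.
  - replace (INR m * (y - INR k / INR m)) with (INR m * y - INR k) by (field; lra).
    rewrite Rinv_r by lra. lra. }
destruct (Rle_lt_dec 0 x) as [H|H].
- destruct (Key x ltac:(lra)) as [k [Hk [K1 K2]]]. exists (m + k)%nat.
  split; [lia|]. rewrite plus_INR.
  replace ((INR m + INR k - INR m) / INR m) with (INR k / INR m) by (field; lra).
  assert (0 <= INR k / INR m) by (apply Rdiv_le_0_compat; [apply pos_INR|easy]).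
  rewrite !Rabs_pos_eq; lra.
- destruct (Key (- x) ltac:(lra)) as [k [Hk [K1 K2]]]. exists (m - k)%nat.
  split; [lia|]. rewrite minus_INR by easy.
  replace ((INR m - INR k - INR m) / INR m) with (- (INR k / INR m)) by (field; lra).
  assert (0 <= INR k / INR m) by (apply Rdiv_le_0_compat; [apply pos_INR|easy]).
  rewrite Rabs_Ropp, !Rabs_pos_eq, (Rabs_left x) by lra.
  split; [lra|]. apply Rabs_le_between. lra.
Qed.

(** Truncating both coordinates towards [0] keeps a point inside the disk. *)
Lemma disk_net m :
  (0 < m)%nat -> exists l : list C,
    (length l <= (2 * m + 1) * (2 * m + 1))%nat /\
    (forall w, In w l -> Cmod w <= 1) /\
    forall w, Cmod w <= 1 -> exists w', In w' l /\ Cmod (w - w')%C <= 2 / INR m.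
Proof.
intros Hm. assert (Pm : 0 < INR m) by now apply lt_0_INR.
set (G := map (fun j => (INR j - INR m) / INR m) (seq 0 (2 * m + 1))).
exists (filter (fun w : C => if Rle_dec (Cmod w) 1 then true else false)
          (list_prod G G)).
split; [|split].
- eapply Nat.le_trans; [apply filter_length_le|].
  assert (E : length G = (2 * m + 1)%nat).
  { unfold G. now rewrite length_map, length_seq. }
  rewrite <- E. apply Nat.eq_le_incl. exact (length_prod G G).
- intros w I. apply filter_In in I. destruct I as [_ I].
  destruct (Rle_dec (Cmod w) 1); easy.
- intros [x y] Hw. assert (Hxy := Rmax_Cmod (x, y)). simpl in Hxy.
  assert (Hx : -1 <= x <= 1).
  { apply Rabs_le_between. eapply Rle_trans; [apply Rmax_l|].
    eapply Rle_trans; [exact Hxy|exact Hw]. }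
  assert (Hy : -1 <= y <= 1).
  { apply Rabs_le_between. eapply Rle_trans; [apply Rmax_r|].
    eapply Rle_trans; [exact Hxy|exact Hw]. }
  destruct (grid_truncation m x Hm Hx) as [j [Hj [X1 X2]]].
  destruct (grid_truncation m y Hm Hy) as [i [Hi [Y1 Y2]]].
  set (x' := (INR j - INR m) / INR m) in *. set (y' := (INR i - INR m) / INR m) in *.
  exists (x', y'). split.
  + apply filter_In. split.
    * apply in_prod; apply in_map_iff; [exists j|exists i];
        (split; [reflexivity|apply in_seq; lia]).
    * destruct (Rle_dec (Cmod (x', y')) 1) as [_|N]; [reflexivity|].
      exfalso; apply N. eapply Rle_trans; [|exact Hw]. unfold Cmod; simpl fst; simpl snd.
      apply sqrt_le_1_alt. apply Rplus_le_compat; rewrite <- !Rsqr_pow2;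
        now apply Rsqr_le_abs_1.
  + unfold Cminus, Cplus, Copp; simpl.
    eapply Rle_trans; [apply Cmod_le_Re_Im|].
    unfold Rminus in X2, Y2. lra.
Qed.

Lemma Cmod_pow_minus_le (w w' : C) k :
  Cmod w <= 1 -> Cmod w' <= 1 ->
  Cmod (w ^ k - w' ^ k)%C <= INR k * Cmod (w - w')%C.
Proof.
intros H H'. induction k as [|k IH].
- simpl. replace (1 - 1)%C with (RtoC 0) by ring. rewrite Cmod_0; lra.
- rewrite !Cpow_S, S_INR.
  replace (w * w ^ k - w' * w' ^ k)%C
    with (w * (w ^ k - w' ^ k) + (w - w') * w' ^ k)%C by ring.
  eapply Rle_trans; [apply Cmod_triangle|]. rewrite !Cmod_mult, Cmod_pow.
  assert (0 <= Cmod w' ^ k <= 1).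
  { split; [apply pow_le, Cmod_ge_0|]. rewrite <- (pow1 k).
    apply pow_incr. split; [apply Cmod_ge_0|easy]. }
  generalize (Cmod_ge_0 w), (Cmod_ge_0 (w - w')%C),
    (Cmod_ge_0 (w ^ k - w' ^ k)%C); intros.
  assert (Cmod w * Cmod (w ^ k - w' ^ k)%C <= Cmod (w ^ k - w' ^ k)%C) by nra.
  nra.
Qed.

(** A random polynomial of degree less than [n] with independent centred
    coefficients of order [1] has supremum of order [sqrt (n log n)].  Being
    larger by [sqrt (log n)] is harmless, as it changes the entropy by
    [O(n log log n)] only; in exchange the parameter [t] of the exponential
    potential can be [1 / sqrt (2 n)], which keeps the potential within a
    constant factor of the size of the family. *)
Definition spread (n : nat) : R :=
  2 + 2 * (sqrt (2 * INR n) * (2 + ln (100 * INR n ^ 4))).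

Lemma balanced_Cpoly n (a b : nat -> C) :
  (2 <= n)%nat -> (forall k, around_0 (a k) (b k)) ->
  exists e : nat -> C, (forall k, corner (a k) (b k) (e k)) /\
    forall w, Cmod w <= 1 -> Cmod (Cpoly e n w) <= spread n.
Proof.
intros Hn Hab. assert (Pn : 2 <= INR n) by (apply (le_INR 2); lia).
destruct (disk_net (2 * (n * n)) ltac:(nia)) as [net [Ln [Hin Hnet]]].
set (l := list_prod ((1, 0) :: (-1, 0) :: (0, 1) :: (0, -1) :: nil) net : list (C * C)).
set (sq := sqrt (2 * INR n)).
assert (Hsq : sq * sq = 2 * INR n) by (apply sqrt_sqrt; lra).
assert (Psq : 2 <= sq).
{ apply Rle_trans with (sqrt (2 ^ 2)); [rewrite sqrt_pow2; lra|].
  apply sqrt_le_1_alt. lra. }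
set (t := / sq).
assert (Ht : 0 <= t <= / 2).
{ unfold t. split; [left; apply Rinv_0_lt_compat; lra|apply Rinv_le_contravar; lra]. }
assert (Ht2 : 2 * t ^ 2 = / INR n).
{ unfold t. rewrite pow_inv. simpl pow. rewrite Rmult_1_r, Hsq. field. lra. }
assert (Hg : forall (c : C * C) k, In c l -> Cmod (fst c * snd c ^ k)%C <= 1).
{ intros [z w] k I. apply in_prod_iff in I. destruct I as [Iz Iw]. simpl fst; simpl snd.
  assert (Ez : Cmod z = 1).
  { assert (M : forall x y, x ^ 2 + y ^ 2 = 1 -> Cmod (x, y) = 1).
    { intros x y E. unfold Cmod; simpl fst; simpl snd. rewrite E. apply sqrt_1. }
    destruct Iz as [<-|[<-|[<-|[<-|[]]]]]; apply M; ring. }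
  rewrite Cmod_mult, Ez, Cmod_pow, Rmult_1_l, <- (pow1 k).
  apply pow_incr. split; [apply Cmod_ge_0|auto]. }
destruct (balance l (fun c k => fst c * snd c ^ k)%C t a b n Hg Ht Hab) as [e [He Hb]].
exists e. split; [exact He|].
set (T := sq * (2 + ln (100 * INR n ^ 4))).
assert (P4 : 0 < INR n ^ 4) by (apply pow_lt; lra).
assert (Form : forall c, In c l -> Re (fst c * Cpoly e n (snd c))%C <= T).
{ intros c Ic.
  assert (X := le_lsum (fun c => exp (t * Re (Csum (fun k => fst c * snd c ^ k * e k)%C n)))
    l c (fun c => Rlt_le _ _ (exp_pos _)) Ic).
  assert (E : Csum (fun k => fst c * snd c ^ k * e k)%C n = (fst c * Cpoly e n (snd c))%C).
  { unfold Cpoly. rewrite <- Csum_mult_l. apply Csum_ext. intros; ring. }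
  cbv beta in X. rewrite E in X.
  assert (Y : exp (t * Re (fst c * Cpoly e n (snd c))%C) <= exp (2 + ln (100 * INR n ^ 4))).
  { eapply Rle_trans; [exact X|]. eapply Rle_trans; [exact Hb|].
    rewrite exp_plus, exp_ln by lra. apply Rmult_le_compat.
    - apply pow_le. rewrite Ht2. assert (0 < / INR n) by (apply Rinv_0_lt_compat; lra). lra.
    - apply pos_INR.
    - rewrite Ht2. rewrite pow_mult.
      apply Rle_trans with ((exp (/ INR n) ^ 2) ^ n).
      + apply pow_incr. split.
        * apply pow2_ge_0.
        * apply pow_incr. assert (0 < / INR n) by (apply Rinv_0_lt_compat; lra).
          split; [lra|apply exp_ineq1_le].
      + rewrite <- pow_mult, exp_pow. right. f_equal.
        rewrite mult_INR. simpl INR. field. lra.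
    - unfold l. rewrite length_prod.
      apply Rle_trans with (INR (4 * ((2 * (2 * (n * n)) + 1) * (2 * (2 * (n * n)) + 1)))).
      + apply le_INR. apply Nat.mul_le_mono; [simpl; lia|exact Ln].
      + rewrite !mult_INR, !plus_INR, !mult_INR. simpl INR.
        set (x := INR n) in *. assert (1 <= x * x) by nra.
        replace (100 * x ^ 4) with (4 * (5 * (x * x)) * (5 * (x * x))) by ring.
        nra. }
  assert (Z : t * Re (fst c * Cpoly e n (snd c))%C <= 2 + ln (100 * INR n ^ 4)).
  { apply Rnot_lt_le; intros F. apply exp_increasing in F. lra. }
  unfold T. apply Rmult_le_reg_l with t; [unfold t; apply Rinv_0_lt_compat; lra|].
  replace (t * (sq * (2 + ln (100 * INR n ^ 4)))) with (2 + ln (100 * INR n ^ 4));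
    [exact Z|]. unfold t. field. lra. }
intros w Hw. destruct (Hnet w Hw) as [w' [Iw Dw]].
assert (Hw' := Hin w' Iw).
assert (B1 : Cmod (Cpoly e n w') <= 2 * T).
{ assert (Il : forall z, In z ((1, 0) :: (-1, 0) :: (0, 1) :: (0, -1) :: nil) ->
    In (z, w') l) by (intros z Iz; now apply in_prod).
  simpl In in Il.
  assert (F1 := Form ((1, 0), w') (Il (1, 0) ltac:(tauto))).
  assert (F2 := Form ((-1, 0), w') (Il (-1, 0) ltac:(tauto))).
  assert (F3 := Form ((0, 1), w') (Il (0, 1) ltac:(tauto))).
  assert (F4 := Form ((0, -1), w') (Il (0, -1) ltac:(tauto))).
  simpl fst in *; simpl snd in *.
  destruct (Cpoly e n w') as [u v]. unfold Re, Cmult in *. simpl fst in *; simpl snd in *.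
  eapply Rle_trans; [apply Cmod_le_Re_Im|].
  assert (Rabs u <= T) by (apply Rabs_le_between; lra).
  assert (Rabs v <= T) by (apply Rabs_le_between; lra). lra. }
assert (B2 : Cmod (Cpoly e n w - Cpoly e n w')%C <= 2).
{ unfold Cpoly. rewrite <- Csum_minus.
  eapply Rle_trans.
  - apply (Cmod_Csum_le _ (fun _ => 2 / INR n)). intros k Hk.
    replace (e k * w ^ k - e k * w' ^ k)%C with (e k * (w ^ k - w' ^ k))%C by ring.
    rewrite Cmod_mult.
    assert (D := Cmod_pow_minus_le w w' k Hw Hw').
    assert (Ek := corner_Cmod_le_2 _ _ _ (Hab k) (He k)).
    assert (Kn : INR k <= INR n) by (apply le_INR; lia).
    apply Rle_trans with (2 * (INR n * (2 / INR (2 * (n * n))))).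
    + apply Rmult_le_compat; auto using Cmod_ge_0.
      eapply Rle_trans; [exact D|].
      apply Rmult_le_compat; auto using Cmod_ge_0, pos_INR.
    + right. rewrite !mult_INR. simpl INR. field. lra.
  - rewrite Rsum_const. right. field. lra. }
replace (Cpoly e n w) with (Cpoly e n w' + (Cpoly e n w - Cpoly e n w'))%C by ring.
eapply Rle_trans; [apply Cmod_triangle|]. unfold spread. fold sq. fold T. lra.
Qed.

(** * Coverings and packings of the class *)

Lemma fun_choice {A B : Type} (P : A -> B -> Prop) :
  (forall x, exists y, P x y) -> exists f, forall x, P x (f x).
Proof.
intros H. exists (fun x => proj1_sig (constructive_indefinite_description _ (H x))).
intros x. apply proj2_sig.
Qed.

Lemma disk_sup_le rho f M :
  (forall z, in_disk rho z -> Cmod (f z) <= M) -> Rbar_le (disk_sup rho f) (Finite M).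
Proof.
intros H. apply (Lub_Rbar_correct (fun x => exists z, in_disk rho z /\ x = Cmod (f z))).
intros x [z [Hz ->]]. simpl. auto.
Qed.

Lemma le_disk_sup rho f z :
  in_disk rho z -> Rbar_le (Finite (Cmod (f z))) (disk_sup rho f).
Proof.
intros Hz. apply (Lub_Rbar_correct (fun x => exists z, in_disk rho z /\ x = Cmod (f z))).
now exists z.
Qed.

Lemma disk_sup_bounded_finite rho f M :
  0 < rho -> (forall z, in_disk rho z -> Cmod (f z) <= M) -> is_finite (disk_sup rho f).
Proof.
intros Hr H. assert (H1 := disk_sup_le rho f M H).
assert (H2 := le_disk_sup rho f 0%C). unfold in_disk in H2. rewrite Cmod_0 in H2.
specialize (H2 Hr). destruct (disk_sup rho f); simpl in *; easy.
Qed.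

Lemma bounded_of_finite rho f :
  is_finite (disk_sup rho f) ->
  forall z, in_disk rho z -> Cmod (f z) <= real (disk_sup rho f).
Proof.
intros F z Hz. assert (H := le_disk_sup rho f z Hz). rewrite <- F in H. exact H.
Qed.

Lemma disk_dist_le rho f g e :
  0 < rho -> (forall z, in_disk rho z -> Cmod (f z - g z)%C <= e) ->
  disk_dist rho f g <= e.
Proof.
intros Hr H. unfold disk_dist.
assert (F := disk_sup_bounded_finite rho (fun z => f z - g z)%C e Hr H).
assert (L := disk_sup_le rho (fun z => f z - g z)%C e H).
rewrite <- F in L. exact L.
Qed.

Lemma disk_dist_bounds rho f g z :
  0 < rho -> bounded_analytic rho f -> bounded_analytic rho g -> in_disk rho z ->
  Cmod (f z - g z)%C <= disk_dist rho f g.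
Proof.
intros Hr [_ Ff] [_ Fg] Hz. unfold disk_dist.
refine (bounded_of_finite rho (fun z => f z - g z)%C _ z Hz).
apply (disk_sup_bounded_finite _ _
  (real (disk_sup rho f) + real (disk_sup rho g)) Hr).
intros y Hy. unfold Cminus. eapply Rle_trans; [apply Cmod_triangle|].
rewrite Cmod_opp. apply Rplus_le_compat; now apply bounded_of_finite.
Qed.

Lemma Cpoly_bounded_analytic rho c n : 0 < rho -> bounded_analytic rho (Cpoly c n).
Proof.
intros Hr. split; [apply Cpoly_analytic|].
apply (disk_sup_bounded_finite _ _ (Rsum (fun k => Cmod (c k) * rho ^ k) n) Hr).
intros z Hz. apply Cmod_Csum_le. intros k _. rewrite Cmod_mult, Cmod_pow.
apply Rmult_le_compat_l; [apply Cmod_ge_0|]. apply pow_incr.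
split; [apply Cmod_ge_0|]. unfold in_disk in Hz; lra.
Qed.

Lemma Cpoly_scale_arg (c : nat -> C) n (s z : C) :
  Cpoly (fun k => c k * s ^ k)%C n z = Cpoly c n (z * s)%C.
Proof. apply Csum_ext. intros k _. rewrite Cpow_mult_l. ring. Qed.

Lemma Cpoly_coef_le (c : nat -> C) n r B k :
  0 < r -> (forall z, Cmod z < r -> Cmod (Cpoly c n z) <= B) -> (k < n)%nat ->
  Cmod (c k) * r ^ k <= B.
Proof.
intros Hr HB Hk.
assert (H := cauchy_estimate (Cpoly c n) r B
  (fun k => if Nat.ltb k n then c k else 0%C) k Hr). cbv beta in H.
rewrite (proj2 (Nat.ltb_lt _ _) Hk) in H. apply H; [|apply Cpoly_jet_origin|exact HB].
intros z Hz. destruct (analytic_jet r (Cpoly c n) z (Cpoly_analytic _ _ _) Hz) as [b Hb].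
now exists b.
Qed.

Fixpoint nprod (N : nat -> nat) (n : nat) : nat :=
  match n with O => 1%nat | S m => (nprod N m * N m)%nat end.

Lemma nprod_pos N n : (forall k, (0 < N k)%nat) -> (0 < nprod N n)%nat.
Proof. intros H; induction n as [|n IH]; simpl; [lia|]. specialize (H n). nia. Qed.

Lemma ln_nprod N n :
  (forall k, (0 < N k)%nat) -> ln (INR (nprod N n)) = Rsum (fun k => ln (INR (N k))) n.
Proof.
intros H; induction n as [|n IH]; simpl nprod; [apply ln_1|].
rewrite mult_INR, ln_mult, IH; [reflexivity| |]; apply lt_0_INR; [|apply H].
now apply nprod_pos.
Qed.

(** Numbering the points of a grid by integers avoids cardinals of sets of
    functions: surjectivity of the digits serves to list the centres of a
    covering, injectivity to count a packing. *)
Lemma mixed_radix (N : nat -> nat) n :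
  (forall k, (0 < N k)%nat) ->
  exists dig : nat -> nat -> nat,
    (forall j k, (dig j k < N k)%nat) /\
    (forall j j', (j < nprod N n)%nat -> (j' < nprod N n)%nat ->
       (forall k, (k < n)%nat -> dig j k = dig j' k) -> j = j') /\
    (forall u : nat -> nat, (forall k, (u k < N k)%nat) ->
       exists j, (j < nprod N n)%nat /\ forall k, (k < n)%nat -> dig j k = u k).
Proof.
intros HN. induction n as [|n [dig [Hlt [Hinj Hsurj]]]].
- exists (fun _ _ => O). split; [|split]; simpl.
  + intros _ k. apply HN.
  + lia.
  + intros u _. exists O. split; lia.
- assert (PP := nprod_pos N n HN).
  set (P := nprod N n) in *.
  exists (fun j k => if Nat.eqb k n then ((j / P) mod N n)%nat else dig (j mod P)%nat k).
  assert (HNn := HN n).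
  split; [|split].
  + intros j k. destruct (Nat.eqb_spec k n) as [->|_]; [|apply Hlt].
    apply Nat.mod_upper_bound. lia.
  + simpl nprod. fold P. intros j j' Hj Hj' E.
    assert (E1 : (j mod P = j' mod P)%nat).
    { apply Hinj; try (apply Nat.mod_upper_bound; lia).
      intros k Hk. specialize (E k ltac:(lia)).
      destruct (Nat.eqb_spec k n); [lia|easy]. }
    assert (E2 := E n ltac:(lia)). rewrite Nat.eqb_refl in E2.
    rewrite !Nat.mod_small in E2 by (apply Nat.Div0.div_lt_upper_bound; lia).
    rewrite (Nat.div_mod_eq j P), (Nat.div_mod_eq j' P). congruence.
  + intros u Hu. destruct (Hsurj u Hu) as [j [Hj E]].
    exists (P * u n + j)%nat. assert (Hun := Hu n). split.
    { simpl nprod. fold P. nia. }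
    assert (Ed : ((P * u n + j) / P = u n)%nat).
    { symmetry. apply (Nat.div_unique _ P (u n) j); lia. }
    assert (Em : ((P * u n + j) mod P = j)%nat).
    { symmetry. apply (Nat.mod_unique _ P (u n) j); lia. }
    intros k Hk. rewrite Ed, Em. destruct (Nat.eqb_spec k n) as [->|].
    * now apply Nat.mod_small.
    * apply E. lia.
Qed.

Lemma packing_le_covering {T : Type} (P : nat) (l : list T) (Rel : nat -> T -> Prop) :
  (forall j, (j < P)%nat -> exists c, In c l /\ Rel j c) ->
  (forall j j' c, (j < P)%nat -> (j' < P)%nat -> Rel j c -> Rel j' c -> j = j') ->
  (P <= length l)%nat.
Proof.
intros H Inj.
destruct P as [|P0]; [lia|]. set (P := S P0) in *.
destruct (H O ltac:(unfold P; lia)) as [c0 _].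
destruct (fun_choice (fun j c => (j < P)%nat -> In c l /\ Rel j c)) as [g Hg].
{ intros j. destruct (Nat.lt_ge_cases j P) as [L|G].
  - destruct (H j L) as [c Hc]. exists c. auto.
  - exists c0. lia. }
rewrite <- (length_seq P 0), <- (length_map g).
apply NoDup_incl_length.
- apply NoDup_map_NoDup_ForallPairs; [|apply seq_NoDup].
  intros x y Ix Iy E. apply in_seq in Ix, Iy.
  apply (Inj x y (g x)); try lia.
  + apply Hg. lia.
  + rewrite E. apply Hg. lia.
- intros c I. apply in_map_iff in I. destruct I as [j [<- I]]. apply in_seq in I.
  apply Hg. lia.
Qed.

Definition nup (x : R) : nat := Z.to_nat (up x).

Lemma nup_spec x : 0 <= x -> x < INR (nup x) <= x + 1.
Proof.
intros Hx. destruct (archimed x) as [H1 H2]. unfold nup.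
assert (0 < up x)%Z by (apply lt_IZR; simpl; lra).
rewrite INR_IZR_INZ, Z2Nat.id by lia. lra.
Qed.

Lemma nup_pos x : 0 <= x -> (0 < nup x)%nat.
Proof. intros Hx. apply INR_lt. simpl. destruct (nup_spec x Hx). lra. Qed.

Lemma lt_nup_le x d : 0 <= x -> (d < nup x)%nat -> INR d <= x.
Proof.
intros Hx Hd. destruct (nup_spec x Hx) as [_ H]. apply le_INR in Hd.
rewrite S_INR in Hd. lra.
Qed.

Lemma spread_ge_2 n : (2 <= n)%nat -> 2 <= spread n.
Proof.
intros Hn. assert (2 <= INR n) by (apply (le_INR 2); lia).
unfold spread. assert (S0 := sqrt_pos (2 * INR n)).
assert (0 <= ln (100 * INR n ^ 4)).
{ rewrite <- ln_1. apply ln_le; [lra|].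
  assert (1 <= INR n ^ 4) by (apply pow_R1_Rle; lra). lra. }
assert (0 <= sqrt (2 * INR n) * (2 + ln (100 * INR n ^ 4)))
  by (apply Rmult_le_pos; lra).
lra.
Qed.

Lemma round_options x K :
  Rabs x < INR K -> exists i, (i + 1 <= 2 * K)%nat /\
    0 <= x - (INR i - INR K) <= 1.
Proof.
intros H. apply Rabs_lt_between in H.
assert (H0 : 0 <= x + INR K) by lra.
exists (nup (x + INR K) - 1)%nat.
assert (P := nup_pos _ H0). destruct (nup_spec _ H0) as [N1 N2].
split.
- assert (nup (x + INR K) < 2 * K + 1)%nat; [|lia].
  apply INR_lt. rewrite plus_INR, mult_INR. simpl INR. lra.
- rewrite minus_INR by lia. simpl INR. lra.
Qed.

(** The grid has side [h] with [h * spread n = eps / 2].  A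
    polynomial is rounded to the grid by balancing, so the rounding errors of its
    coefficients almost cancel instead of adding up: this is what saves a factor
    [sqrt n], up to logarithms, on the side of the cells. *)
Lemma covering_upper_bound r r' M eps n :
  0 < r < r' -> 0 < M -> 0 < eps -> (2 <= n)%nat ->
  M * (r / r') ^ n / (1 - r / r') <= eps / 2 ->
  exists l, is_covering (disk_dist r) (bounded_analytic r) (analytic_class r' M) eps l /\
    (0 < length l)%nat /\
    ln (INR (length l)) <=
      Rsum (fun k => 2 * ln (4 * M * (r / r') ^ k * spread n / eps + 3)) n.
Proof.
intros Hr HM He Hn Htail.
assert (HS := spread_ge_2 n Hn). set (S := spread n) in *.
set (h := eps / (2 * S)). assert (Hh : 0 < h) by (apply Rdiv_lt_0_compat; lra).
assert (HhS : h * S = eps / 2) by (unfold h; field; lra).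
set (q := r / r') in *.
assert (Hq : 0 < q) by (apply Rdiv_lt_0_compat; lra).
set (X := fun k => M * q ^ k / h).
assert (HX : forall k, 0 <= X k).
{ intros k. apply Rdiv_le_0_compat; [|easy].
  apply Rmult_le_pos; [lra|apply pow_le; lra]. }
set (K := fun k => nup (X k)).
set (N1 := fun k => (2 * K k + 1)%nat).
set (N := fun k => (N1 k * N1 k)%nat).
assert (HN1 : forall k, (0 < N1 k)%nat) by (intros k; unfold N1; lia).
assert (HN : forall k, (0 < N k)%nat) by (intros k; unfold N; specialize (HN1 k); nia).
destruct (mixed_radix N n HN) as [dig [_ [_ Hsurj]]].
set (u := fun k d => (INR (d / N1 k) - INR (K k), INR (d mod N1 k) - INR (K k)) : C).
set (cen := fun j => Cpoly (fun k => h * u k (dig j k) * (/ r) ^ k)%C n).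
exists (map cen (seq 0 (nprod N n))).
rewrite length_map, length_seq. split; [split|split].
- apply Forall_forall. intros c I. apply in_map_iff in I. destruct I as [j [<- _]].
  apply Cpoly_bounded_analytic. lra.
- intros f [Af Bf].
  assert (Bf' : forall z, Cmod z < r' -> Cmod (f z) <= M).
  { intros z Hz. assert (L := le_disk_sup r' f z Hz).
    exact (Rbar_le_trans _ _ _ L Bf). }
  destruct (taylor_estimate f r r' M Hr Af Bf') as [a [Ha Hrem]].
  set (b := fun k => (a k * r ^ k / h)%C).
  assert (Nh : RtoC h <> 0%C) by (intros E; apply RtoC_inj in E; lra).
  assert (Nr : RtoC r <> 0%C) by (intros E; apply RtoC_inj in E; lra).
  assert (Hb : forall k, Cmod (b k) <= X k).
  { intros k. unfold b, X. rewrite Cmod_div, Cmod_mult, Cmod_pow, !Cmod_R by easy.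
    rewrite !Rabs_pos_eq by lra. apply Rmult_le_compat_r.
    - left. now apply Rinv_0_lt_compat.
    - unfold q, Rdiv. rewrite Rpow_mult_distr, pow_inv.
      assert (0 < r' ^ k) by (apply pow_lt; lra). assert (0 < r ^ k) by (apply pow_lt; lra).
      apply Rmult_le_reg_r with (r' ^ k); [easy|].
      replace (M * (r ^ k * / r' ^ k) * r' ^ k) with (M * r ^ k) by (field; lra).
      specialize (Ha k). nra. }
  assert (HK : forall k, Cmod (b k) < INR (K k)).
  { intros k. destruct (nup_spec (X k) (HX k)). specialize (Hb k). unfold K. lra. }
  destruct (fun_choice (fun k i => (i + 1 <= 2 * K k)%nat /\
     0 <= Re (b k) - (INR i - INR (K k)) <= 1)) as [i1 Hi1].
  { intros k. apply round_options. eapply Rle_lt_trans; [apply re_le_Cmod|apply HK]. }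
  destruct (fun_choice (fun k i => (i + 1 <= 2 * K k)%nat /\
     0 <= Im (b k) - (INR i - INR (K k)) <= 1)) as [i2 Hi2].
  { intros k. apply round_options. eapply Rle_lt_trans; [apply Im_le_Cmod|apply HK]. }
  set (hi := fun k => (Re (b k) - (INR (i1 k) - INR (K k)),
                       Im (b k) - (INR (i2 k) - INR (K k))) : C).
  set (lo := fun k => (Re (hi k) - 1, Im (hi k) - 1) : C).
  assert (Ehi1 : forall k, Re (hi k) = Re (b k) - (INR (i1 k) - INR (K k))) by easy.
  assert (Ehi2 : forall k, Im (hi k) = Im (b k) - (INR (i2 k) - INR (K k))) by easy.
  assert (Elo1 : forall k, Re (lo k) = Re (hi k) - 1) by easy.
  assert (Elo2 : forall k, Im (lo k) = Im (hi k) - 1) by easy.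
  destruct (balanced_Cpoly n lo hi Hn) as [e [Ce Be]].
  { intros k. destruct (Hi1 k) as [_ I1]. destruct (Hi2 k) as [_ I2].
    unfold around_0. rewrite Elo1, Elo2, Ehi1, Ehi2. repeat split; lra. }
  assert (Hd : forall k, exists d, (d < N k)%nat /\ u k d = (b k - e k)%C).
  { intros k. destruct (Hi1 k) as [L1 _]. destruct (Hi2 k) as [L2 _].
    destruct (Ce k) as [C1 C2].
    assert (exists j1, (j1 < N1 k)%nat /\ INR j1 - INR (K k) = Re (b k) - Re (e k))
      as [j1 [J1 E1]].
    { destruct C1 as [->| ->]; [exists (i1 k + 1)%nat|exists (i1 k)];
        (split; [unfold N1; lia|]); rewrite ?Elo1, Ehi1, ?plus_INR;
        simpl INR; ring. }
    assert (exists j2, (j2 < N1 k)%nat /\ INR j2 - INR (K k) = Im (b k) - Im (e k))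
      as [j2 [J2 E2]].
    { destruct C2 as [->| ->]; [exists (i2 k + 1)%nat|exists (i2 k)];
        (split; [unfold N1; lia|]); rewrite ?Elo2, Ehi2, ?plus_INR;
        simpl INR; ring. }
    exists (N1 k * j1 + j2)%nat. split; [unfold N; nia|].
    unfold u.
    rewrite <- (Nat.div_unique (N1 k * j1 + j2) (N1 k) j1 j2 J2 eq_refl).
    rewrite <- (Nat.mod_unique (N1 k * j1 + j2) (N1 k) j1 j2 J2 eq_refl).
    rewrite E1, E2. destruct (b k), (e k). reflexivity. }
  destruct (fun_choice _ Hd) as [d Hd'].
  destruct (Hsurj d (fun k => proj1 (Hd' k))) as [j [Hj Ej]].
  exists (cen j). split.
  + apply in_map_iff. exists j. split; [reflexivity|]. apply in_seq. lia.
  + apply disk_dist_le; [lra|]. intros z Hz. unfold in_disk in Hz.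
    assert (Ew : Cmod (z * / r)%C <= 1).
    { rewrite Cmod_mult, Cmod_inv, Cmod_R, Rabs_pos_eq by (easy || lra).
      apply Rmult_le_reg_r with r; [lra|].
      rewrite Rmult_assoc, Rinv_l by lra. lra. }
    assert (E : (Cpoly a n z - cen j z)%C = (h * Cpoly e n (z * / r))%C).
    { unfold cen, Cpoly. rewrite <- Csum_mult_l, <- Csum_minus. apply Csum_ext.
      intros k Hk. rewrite (Ej k Hk), (proj2 (Hd' k)). unfold b.
      rewrite Cpow_mult_l, Cpow_inv by easy. field.
      split; [now apply Cpow_nz|easy]. }
    replace (f z - cen j z)%C with ((f z - Cpoly a n z) + (Cpoly a n z - cen j z))%C by ring.
    eapply Rle_trans; [apply Cmod_triangle|]. rewrite E, Cmod_mult, Cmod_R, Rabs_pos_eq by lra.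
    assert (B1 := Hrem n z Hz). assert (B2 := Be _ Ew). fold q in B1. fold S in B2.
    assert (h * Cmod (Cpoly e n (z * / r)) <= h * S) by (apply Rmult_le_compat_l; lra).
    lra.
- now apply nprod_pos.
- rewrite ln_nprod by easy. apply Rsum_le. intros k _.
  unfold N. rewrite mult_INR.
  assert (P1 : 0 < INR (N1 k)) by (apply lt_0_INR, HN1).
  rewrite ln_mult by easy.
  assert (ln (INR (N1 k)) <= ln (4 * M * q ^ k * S / eps + 3)); [|lra].
  apply ln_le; [easy|]. unfold N1. rewrite plus_INR, mult_INR. simpl INR.
  destruct (nup_spec (X k) (HX k)) as [_ L]. fold (K k) in L.
  replace (4 * M * q ^ k * S / eps) with (2 * X k) by (unfold X, h; field; lra). lra.
Qed.

Lemma Rabs_dist_abs x y s t :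
  0 <= s -> 0 <= t -> (x = - s \/ x = s) -> (y = - t \/ y = t) ->
  Rabs (s - t) <= Rabs (x - y).
Proof.
intros Hs Ht [->| ->] [->| ->]; apply Rabs_le_between;
  unfold Rabs; destruct (Rcase_abs _); lra.
Qed.

Lemma INR_dist_lt_1 a b : Rabs (INR a - INR b) < 1 -> a = b.
Proof.
intros H. apply Rabs_lt_between in H.
destruct (Nat.lt_trichotomy a b) as [L|[L|L]]; [exfalso|exact L|exfalso];
  apply le_INR in L; rewrite S_INR in L; lra.
Qed.

(** Grid points with nonnegative coordinates enter the class once signs are put
    on their coordinates by balancing, and the signs cannot identify two of
    them; Cauchy's estimates make them far apart. *)
Lemma covering_lower_bound r r' M eps n l :
  0 < r < r' -> 0 < M -> 0 < eps -> (2 <= n)%nat ->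
  is_covering (disk_dist r) (bounded_analytic r) (analytic_class r' M) eps l ->
  Rsum (fun k => 2 * ln (M * (r / r') ^ k / (3 * eps * spread n))) n
    <= ln (INR (length l)).
Proof.
intros Hr HM He Hn [Hcen Hcov].
assert (HS := spread_ge_2 n Hn). set (S := spread n) in *.
set (q := r / r') in *.
assert (Hq : 0 < q) by (apply Rdiv_lt_0_compat; lra).
assert (Hqk : forall k, 0 < q ^ k) by (intros k; now apply pow_lt).
set (H := M / S). assert (HH : 0 < H) by (apply Rdiv_lt_0_compat; lra).
set (Y := fun k => M * q ^ k / (3 * eps * S)).
assert (HY : forall k, 0 < Y k).
{ intros k. apply Rdiv_lt_0_compat; [|nra]. apply Rmult_lt_0_compat; auto. }
assert (HHY : forall k, H * q ^ k = 3 * eps * Y k).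
{ intros k. unfold H, Y. field. lra. }
set (N1 := fun k => nup (Y k)).
set (N := fun k => (N1 k * N1 k)%nat).
assert (HN1 : forall k, (0 < N1 k)%nat) by (intros k; apply nup_pos; left; apply HY).
assert (HN : forall k, (0 < N k)%nat) by (intros k; unfold N; specialize (HN1 k); nia).
assert (Hlen : (nprod N n <= length l)%nat).
{ destruct (mixed_radix N n HN) as [dig [Hdig [Hinj _]]].
  set (b := fun j k => (INR (dig j k / N1 k) / Y k, INR (dig j k mod N1 k) / Y k) : C).
  set (a := fun j k => Copp (b j k)).
  assert (Hdiv : forall d k, (d < N1 k)%nat -> 0 <= INR d / Y k <= 1).
  { intros d k Hd. assert (Hy := HY k). split.
    - apply Rdiv_le_0_compat; [apply pos_INR|easy].
    - apply Rmult_le_reg_r with (Y k); [easy|].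
      replace (INR d / Y k * Y k) with (INR d) by (field; lra).
      rewrite Rmult_1_l. apply lt_nup_le; [lra|exact Hd]. }
  assert (Hb : forall j k, 0 <= Re (b j k) <= 1 /\ 0 <= Im (b j k) <= 1).
  { intros j k. specialize (Hdig j k). specialize (HN1 k). unfold N in Hdig.
    split; simpl; apply Hdiv.
    - apply Nat.Div0.div_lt_upper_bound. lia.
    - apply Nat.mod_upper_bound. lia. }
  destruct (fun_choice (fun j e => (forall k, corner (a j k) (b j k) (e k)) /\
     forall w, Cmod w <= 1 -> Cmod (Cpoly e n w) <= S)) as [e Hbal].
  { intros j. apply balanced_Cpoly; [easy|]. intros k. specialize (Hb j k).
    unfold around_0, a. destruct (b j k); simpl in *. repeat split; lra. }
  assert (Nr' : RtoC r' <> 0%C) by (intros E; apply RtoC_inj in E; lra).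
  set (c := fun j k => (H * e j k * (/ r') ^ k)%C).
  assert (Cls : forall j, analytic_class r' M (Cpoly (c j) n)).
  { intros j. split; [apply Cpoly_analytic|]. apply disk_sup_le. intros z Hz.
    unfold in_disk in Hz. unfold c. rewrite Cpoly_scale_arg.
    replace (Cpoly (fun k => H * e j k)%C n (z * / r')%C)
      with (H * Cpoly (e j) n (z * / r'))%C.
    2: { unfold Cpoly. rewrite <- Csum_mult_l. apply Csum_ext. intros; ring. }
    rewrite Cmod_mult, Cmod_R, Rabs_pos_eq by lra.
    replace M with (H * S) by (unfold H; field; lra).
    apply Rmult_le_compat_l; [lra|]. apply Hbal.
    rewrite Cmod_mult, Cmod_inv, Cmod_R, Rabs_pos_eq by (easy || lra).
    apply Rmult_le_reg_r with r'; [lra|]. rewrite Rmult_assoc, Rinv_l by lra. lra. }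
  apply (packing_le_covering _ l (fun j f => In f l /\ disk_dist r (Cpoly (c j) n) f <= eps)).
  - intros j _. destruct (Hcov _ (Cls j)) as [f [If Df]]. now exists f.
  - intros j j' f Hj Hj' [If D1] [_ D2]. apply Hinj; auto.
    assert (Bf := proj1 (Forall_forall _ _) Hcen f If).
    intros k Hk.
    assert (B : Cmod (c j k - c j' k)%C * r ^ k <= 2 * eps).
    { apply (Cpoly_coef_le (fun k => c j k - c j' k)%C n); [lra| |easy].
      intros z Hz. unfold Cpoly.
      rewrite (Csum_ext _ (fun k => c j k * z ^ k - c j' k * z ^ k)%C) by (intros; ring).
      rewrite Csum_minus. fold (Cpoly (c j) n z). fold (Cpoly (c j') n z).
      assert (E1 := disk_dist_bounds r _ f z ltac:(lra)
        (Cpoly_bounded_analytic r (c j) n ltac:(lra)) Bf Hz).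
      assert (E2 := disk_dist_bounds r _ f z ltac:(lra)
        (Cpoly_bounded_analytic r (c j') n ltac:(lra)) Bf Hz).
      replace (Cpoly (c j) n z - Cpoly (c j') n z)%C
        with ((Cpoly (c j) n z - f z) + - (Cpoly (c j') n z - f z))%C by ring.
      eapply Rle_trans; [apply Cmod_triangle|]. rewrite Cmod_opp. lra. }
    replace (c j k - c j' k)%C with (H * (e j k - e j' k) * (/ r') ^ k)%C in B
      by (unfold c; ring).
    rewrite !Cmod_mult, Cmod_pow, Cmod_inv, !Cmod_R, !Rabs_pos_eq in B by (easy || lra).
    assert (B' : 3 * eps * Y k * Cmod (e j k - e j' k) <= 2 * eps).
    { rewrite <- HHY. eapply Rle_trans; [|exact B]. right.
      unfold q, Rdiv. rewrite Rpow_mult_distr. ring. }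
    assert (Small : forall x, Rabs x <= Cmod (e j k - e j' k) -> Y k * Rabs x < 1).
    { intros x Hx. specialize (HY k).
      apply Rmult_lt_reg_l with (3 * eps); [lra|].
      assert (3 * eps * Y k * Rabs x <= 3 * eps * Y k * Cmod (e j k - e j' k)).
      { apply Rmult_le_compat_l; [|exact Hx]. apply Rmult_le_pos; lra. }
      lra. }
    assert (Eq : forall d d' x y, (x = - (INR d / Y k) \/ x = INR d / Y k) ->
      (y = - (INR d' / Y k) \/ y = INR d' / Y k) ->
      Rabs (x - y) <= Cmod (e j k - e j' k) -> d = d').
    { intros d d' x y Hx Hy L. assert (HYk := HY k).
      apply INR_dist_lt_1. eapply Rle_lt_trans; [|apply (Small _ L)].
      replace (INR d - INR d') with (Y k * (INR d / Y k - INR d' / Y k)) by (field; lra).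
      rewrite Rabs_mult, (Rabs_pos_eq (Y k)) by lra.
      apply Rmult_le_compat_l; [lra|].
      apply Rabs_dist_abs; try easy; apply Rdiv_le_0_compat; auto using pos_INR. }
    destruct (Hbal j) as [Cj _]. destruct (Hbal j') as [Cj' _].
    destruct (Cj k) as [R1 I1]. destruct (Cj' k) as [R2 I2].
    assert (Q1 : (dig j k / N1 k = dig j' k / N1 k)%nat).
    { apply (Eq _ _ (Re (e j k)) (Re (e j' k)) R1 R2).
      exact (re_le_Cmod (e j k - e j' k)%C). }
    assert (Q2 : (dig j k mod N1 k = dig j' k mod N1 k)%nat).
    { apply (Eq _ _ (Im (e j k)) (Im (e j' k)) I1 I2).
      exact (Im_le_Cmod (e j k - e j' k)%C). }
    rewrite (Nat.div_mod_eq (dig j k) (N1 k)), (Nat.div_mod_eq (dig j' k) (N1 k)).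
    congruence. }
apply Rle_trans with (ln (INR (nprod N n))).
- rewrite ln_nprod by easy. apply Rsum_le. intros k _. unfold N. rewrite mult_INR.
  assert (P1 : 0 < INR (N1 k)) by (apply lt_0_INR, HN1).
  rewrite ln_mult by easy.
  assert (ln (Y k) <= ln (INR (N1 k))); [|unfold Y in *; lra].
  apply ln_le; [apply HY|]. left. apply nup_spec. left. apply HY.
- apply ln_le; [apply lt_0_INR; now apply nprod_pos|now apply le_INR].
Qed.

(** * Asymptotics of the entropy *)

Lemma covering_number_exists {T : Type} (d : T -> T -> R) (X K : T -> Prop) eps :
  (exists l, is_covering d X K eps l) -> exists N, is_covering_number d X K eps N.
Proof.
intros [l Hl].
assert (H : forall m l, (length l <= m)%nat -> is_covering d X K eps l ->
  exists N, is_covering_number d X K eps N).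
{ clear l Hl. induction m as [|m IH]; intros l Hm Hl.
  - exists (length l). split; [now exists l|]. intros. lia.
  - destruct (classic (exists l', is_covering d X K eps l' /\ (length l' < length l)%nat))
      as [[l' [Hl' Lt]]|No].
    + apply (IH l'); [lia|easy].
    + exists (length l). split; [now exists l|]. intros l' Hl'.
      apply Nat.nlt_ge. intros Lt. apply No. now exists l'. }
exact (H _ l (le_n _) Hl).
Qed.

Lemma entropy_bounds r r' M eps n :
  0 < r < r' -> 0 < M -> 0 < eps -> (2 <= n)%nat ->
  M * (r / r') ^ n / (1 - r / r') <= eps / 2 ->
  exists N,
    is_covering_number (disk_dist r) (bounded_analytic r) (analytic_class r' M) eps N /\
    Rsum (fun k => 2 * ln (M * (r / r') ^ k / (3 * eps * spread n))) n <= ln (INR N) /\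
    ln (INR N) <= Rsum (fun k => 2 * ln (4 * M * (r / r') ^ k * spread n / eps + 3)) n.
Proof.
intros Hr HM He Hn Ht.
destruct (covering_upper_bound r r' M eps n Hr HM He Hn Ht) as [l [Cl [Pl Ul]]].
destruct (covering_number_exists _ _ _ _ (ex_intro _ l Cl)) as [N [[l' [Cl' El']] Least]].
exists N. split; [split; [now exists l'|exact Least]|]. split.
- rewrite <- El'. now apply (covering_lower_bound r r' M eps n l').
- eapply Rle_trans; [|exact Ul].
  (* a covering of the class is not empty, because the class is not *)
  assert (PN : (0 < N)%nat).
  { rewrite <- El'. destruct Cl' as [_ Cov].
    destruct (Cov (Cpoly (fun _ => 0%C) 0)) as [c [Ic _]].
    - split; [apply Cpoly_analytic|]. apply disk_sup_le. intros z _.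
      unfold Cpoly; simpl. rewrite Cmod_0. lra.
    - destruct l'; [destruct Ic|simpl; lia]. }
  apply ln_le; [now apply lt_0_INR|]. now apply le_INR, Least.
Qed.

Lemma Rsum_arith x y n :
  Rsum (fun k => 2 * (x - INR k * y)) n = 2 * INR n * x - y * INR n * (INR n - 1).
Proof.
induction n as [|n IH]; [simpl; ring|].
rewrite S_INR. simpl. rewrite IH. ring.
Qed.

Lemma ln_pow_nat q k : 0 < q -> ln (q ^ k) = INR k * ln q.
Proof.
intros Hq. induction k as [|k IH]; [simpl; rewrite ln_1; ring|].
rewrite S_INR. simpl. rewrite ln_mult, IH; [ring|easy|now apply pow_lt].
Qed.

(** With [l = ln (1 / eps)] and [La = ln (r' / r)], the number [n] of
    coefficients exceeds [l / La] by a bounded amount [theta], just enough for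
    the tail of the Taylor series to be below [eps / 2].  As
    [2 n l - La n^2 = l^2 / La - La theta^2], the leading term does not depend
    on [theta].  The bound on [eps] makes [n] at least [2]. *)
Lemma entropy_in_n r r' M :
  0 < r < r' -> 0 < M ->
  exists D C : R, 0 <= D /\ 0 <= C /\
    forall eps, 0 < eps < exp (- (2 * ln (r' / r))) ->
    exists (n N : nat),
      ln (/ eps) / ln (r' / r) <= INR n <= ln (/ eps) / ln (r' / r) + D /\
      is_covering_number (disk_dist r) (bounded_analytic r) (analytic_class r' M) eps N /\
      Rabs (ln (INR N) - ln (/ eps) ^ 2 / ln (r' / r))
        <= INR n * (2 * ln (spread n) + C).
Proof.
intros Hr HM.
set (q := r / r'). set (La := ln (r' / r)).
assert (Hq : 0 < q < 1).
{ split; [apply Rdiv_lt_0_compat; lra|]. unfold q.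
  apply Rmult_lt_reg_r with r'; [lra|].
  replace (r / r' * r') with r by (field; lra). lra. }
assert (Hlq : ln q = - La).
{ unfold q, La. rewrite <- ln_Rinv; [f_equal; field; lra|].
  apply Rdiv_lt_0_compat; lra. }
assert (HLa : 0 < La).
{ assert (ln q < 0); [|lra]. rewrite <- ln_1. apply ln_increasing; lra. }
destruct (pow_lt_1_zero q ltac:(rewrite Rabs_pos_eq; lra) ((1 - q) / (2 * M))
  ltac:(apply Rdiv_lt_0_compat; lra)) as [n0 Hn0].
specialize (Hn0 n0 (le_n _)).
assert (Pn0 : 0 < q ^ n0) by (apply pow_lt; lra).
rewrite Rabs_pos_eq in Hn0 by lra.
set (A := 4 * M + 3 / (2 * (q ^ n0 * q))).
assert (Pnq : 0 < q ^ n0 * q) by (apply Rmult_lt_0_compat; lra).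
assert (P3 : 0 < 3 / (2 * (q ^ n0 * q))) by (apply Rdiv_lt_0_compat; lra).
assert (HA : 0 < A) by (unfold A; lra).
set (D := INR n0 + 1). assert (HD : 1 <= D) by (unfold D; generalize (pos_INR n0); lra).
set (C0 := Rabs (ln A) + Rabs (ln (M / 3))).
assert (HC0 : 0 <= C0).
{ unfold C0. generalize (Rabs_pos (ln A)), (Rabs_pos (ln (M / 3))). lra. }
set (C := 2 * C0 + La + La * D ^ 2).
assert (HLD : 0 <= La * D ^ 2) by (apply Rmult_le_pos; [lra|apply pow2_ge_0]).
exists D, C. split; [lra|]. split; [unfold C; lra|].
intros eps [He He1].
set (l := ln (/ eps)).
assert (Hl : 2 * La < l).
{ unfold l. rewrite ln_Rinv by easy. apply ln_increasing in He1; [|easy].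
  rewrite ln_exp in He1. fold La in He1. lra. }
assert (Heps : eps = exp (- l)).
{ unfold l. rewrite ln_Rinv, Ropp_involutive by easy. now rewrite exp_ln. }
assert (Hll : 2 < l / La).
{ apply Rmult_lt_reg_r with La; [easy|].
  replace (l / La * La) with l by (field; lra). lra. }
destruct (nup_spec (l / La) ltac:(lra)) as [Nu1 Nu2].
set (m := nup (l / La)) in *. set (n := (n0 + m)%nat).
set (theta := INR n - l / La).
assert (Hth : 0 <= theta <= D).
{ unfold theta, n, D. rewrite plus_INR. generalize (pos_INR n0). lra. }
assert (Hn : INR n = l / La + theta) by (unfold theta; ring).
assert (Hn2 : 2 <= INR n) by lra.
assert (Hqm : eps * q <= q ^ m <= eps).
{ assert (E : q ^ m = exp (- (INR m * La))).
  { rewrite <- (exp_ln (q ^ m)) by (apply pow_lt; lra).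
    rewrite ln_pow_nat, Hlq by easy. f_equal. ring. }
  assert (La * (l / La) = l) by (field; lra).
  assert (mono : forall x y, x <= y -> exp x <= exp y).
  { intros x y [H1| ->]; [left; now apply exp_increasing|lra]. }
  split.
  - assert (Eq : q = exp (- La)) by (rewrite <- Hlq, exp_ln; easy).
    rewrite E, Eq, Heps, <- exp_plus. apply mono. nra.
  - rewrite E, Heps. apply mono. nra. }
assert (Hqn : q ^ n = q ^ n0 * q ^ m) by (unfold n; now rewrite pow_add).
assert (Tail : M * q ^ n / (1 - q) <= eps / 2).
{ rewrite Hqn.
  assert (X : M * q ^ n0 <= (1 - q) / 2).
  { apply Rle_trans with (M * ((1 - q) / (2 * M))); [|right; field; lra].
    apply Rmult_le_compat_l; lra. }
  apply Rmult_le_reg_r with (1 - q); [lra|].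
  replace (M * (q ^ n0 * q ^ m) / (1 - q) * (1 - q)) with (M * q ^ n0 * q ^ m)
    by (field; lra).
  apply Rle_trans with ((1 - q) / 2 * eps); [|right; field].
  apply Rmult_le_compat; try lra.
  - apply Rmult_le_pos; lra.
  - left. apply pow_lt; lra. }
assert (Hn2' : (2 <= n)%nat) by (apply INR_le; exact Hn2).
destruct (entropy_bounds r r' M eps n Hr HM He Hn2' Tail) as [N [CN [Lo Up]]].
fold q in Lo, Up.
exists n, N. split; [fold l La; lra|]. split; [exact CN|].
assert (HS := spread_ge_2 n Hn2'). set (S := spread n) in *.
assert (HlnS : 0 <= ln S) by (rewrite <- ln_1; apply ln_le; lra).
assert (Key : forall x, 0 < x -> forall k, ln (x * q ^ k / eps) = ln x + l - INR k * La).
{ intros x Hx k. assert (0 < q ^ k) by (apply pow_lt; lra).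
  unfold Rdiv. rewrite !ln_mult, ln_pow_nat, Hlq; try lra.
  - fold l. ring.
  - apply Rmult_lt_0_compat; lra.
  - now apply Rinv_0_lt_compat. }
assert (Up' : ln (INR N) <= 2 * INR n * (ln (A * S) + l) - La * INR n * (INR n - 1)).
{ rewrite <- Rsum_arith. eapply Rle_trans; [exact Up|]. apply Rsum_le. intros k Hk.
  rewrite <- Key by (apply Rmult_lt_0_compat; lra).
  apply Rmult_le_compat_l; [lra|].
  assert (Pk : 0 < q ^ k) by (apply pow_lt; lra).
  assert (Gk : q ^ n0 * q * eps <= q ^ k).
  { apply Rle_trans with (q ^ n); [rewrite Hqn; nra|].
    replace n with ((n - k) + k)%nat by lia. rewrite pow_add.
    assert (q ^ (n - k) <= 1); [|nra].
    rewrite <- (pow1 (n - k)). apply pow_incr. lra. }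
  apply ln_le.
  - apply Rplus_lt_0_compat; [|lra]. apply Rdiv_lt_0_compat; [|easy].
    repeat apply Rmult_lt_0_compat; lra.
  - replace (A * S * q ^ k / eps)
      with (4 * M * q ^ k * S / eps + 3 / (2 * (q ^ n0 * q)) * S * q ^ k / eps)
      by (unfold A; field; repeat split; lra).
    apply Rplus_le_compat_l.
    apply Rmult_le_reg_r with (2 * (q ^ n0 * q) * eps); [nra|].
    replace (3 / (2 * (q ^ n0 * q)) * S * q ^ k / eps * (2 * (q ^ n0 * q) * eps))
      with (3 * (S * q ^ k)) by (field; repeat split; lra).
    nra. }
assert (Lo' : 2 * INR n * (ln (M / 3 / S) + l) - La * INR n * (INR n - 1) <= ln (INR N)).
{ rewrite <- Rsum_arith. eapply Rle_trans; [|exact Lo]. apply Rsum_le. intros k Hk.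
  right. rewrite <- Key by (repeat apply Rdiv_lt_0_compat; lra).
  do 2 f_equal. field. lra. }
rewrite ln_mult in Up' by lra.
rewrite ln_div in Lo' by (try apply Rdiv_lt_0_compat; lra).
assert (Main : 2 * INR n * l - La * INR n * INR n = l ^ 2 / La - La * theta ^ 2).
{ rewrite Hn. field. lra. }
assert (Th2 : 0 <= La * theta ^ 2 <= La * D ^ 2).
{ split; [apply Rmult_le_pos; [lra|apply pow2_ge_0]|].
  apply Rmult_le_compat_l; [lra|]. apply pow_incr. lra. }
assert (A1' := Rle_abs (ln A)).
assert (A2' : - ln (M / 3) <= Rabs (ln (M / 3))) by (rewrite <- Rabs_Ropp; apply Rle_abs).
assert (A3' := Rabs_pos (ln A)). assert (A4' := Rabs_pos (ln (M / 3))).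
assert (ln A <= C0) by (unfold C0; lra).
assert (- ln (M / 3) <= C0) by (unfold C0; lra).
assert (INR n * ln A <= INR n * C0) by (apply Rmult_le_compat_l; lra).
assert (INR n * - ln (M / 3) <= INR n * C0) by (apply Rmult_le_compat_l; lra).
assert (La * D ^ 2 <= INR n * (La * D ^ 2)) by nra.
assert (0 <= INR n * ln S) by (apply Rmult_le_pos; lra).
assert (0 <= INR n * La) by (apply Rmult_le_pos; lra).
assert (0 <= INR n * C0) by (apply Rmult_le_pos; lra).
apply Rabs_le_between. unfold C. split; lra.
Qed.

(** The constant comes from [2 <= 2 sqrt n ln n] and from
    [2 sqrt 2 (2 + ln 100 + 4 ln n) <= (24 + 2 sqrt 2 ln 100) ln n], as
    [sqrt 2 <= 2] and [1 <= ln n]. *)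
Lemma ln_spread_le n :
  3 <= INR n ->
  2 * ln (spread n) <= ln (INR n) + 2 * ln (ln (INR n)) + 2 * ln (26 + 2 * sqrt 2 * ln 100).
Proof.
intros Hn. set (x := INR n) in *.
assert (L1 : 1 <= ln x).
{ rewrite <- (ln_exp 1). apply ln_le; [apply exp_pos|].
  generalize exp_le_3. lra. }
assert (S2 := sqrt_pos 2).
assert (S2' : sqrt 2 <= 2).
{ apply Rle_trans with (sqrt (2 ^ 2)); [apply sqrt_le_1_alt; lra|].
  rewrite sqrt_pow2; lra. }
assert (Sx : 1 <= sqrt x).
{ rewrite <- sqrt_1. apply sqrt_le_1_alt. lra. }
assert (H100 : 0 <= ln 100) by (rewrite <- ln_1; apply ln_le; lra).
set (C := 26 + 2 * sqrt 2 * ln 100).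
assert (HC : 0 < C) by (unfold C; nra).
assert (E : ln x + 2 * ln (ln x) + 2 * ln C = 2 * ln (C * (sqrt x * ln x))).
{ rewrite !ln_mult by (try apply Rmult_lt_0_compat; lra).
  rewrite <- (sqrt_sqrt x) at 1 by lra. rewrite ln_mult by lra. ring. }
rewrite E. apply Rmult_le_compat_l; [lra|].
assert (Hn2 : (2 <= n)%nat) by (apply INR_le; simpl INR; fold x; lra).
apply ln_le; [generalize (spread_ge_2 n Hn2); lra|].
unfold spread. fold x. rewrite sqrt_mult by lra.
rewrite ln_mult, ln_pow_nat by (try apply pow_lt; lra). simpl INR.
set (s := sqrt x) in *. set (t := sqrt 2) in *. set (u := ln x) in *.
set (v := ln 100) in *.
assert (s * 1 <= s * u) by (apply Rmult_le_compat_l; lra).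
assert (t * s * (2 + (v + (1+1+1+1) * u)) <= t * (6 + v) * (s * u)).
{ replace (t * s * (2 + (v + (1+1+1+1) * u))) with (t * (2 * s + v * s + 4 * (s * u))) by ring.
  replace (t * (6 + v) * (s * u)) with (t * (2 * (s * u) + v * (s * u) + 4 * (s * u))) by ring.
  apply Rmult_le_compat_l; [easy|].
  assert (v * s <= v * (s * u)) by (apply Rmult_le_compat_l; lra). lra. }
assert (t * (6 + v) * (s * u) <= (12 + t * v) * (s * u)).
{ apply Rmult_le_compat_r; [apply Rmult_le_pos; lra|]. lra. }
unfold C. nra.
Qed.

(** The two factors of the bound come from estimates of the two factors of
    [entropy_in_n]: the number of coefficients is at most
    [(l / La) (1 + D / y)], with [l] and [La] as there, and
    [2 ln (spread n)] is at most [y + 2 ln y + O(1)]. *)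
Lemma entropy_estimate r r' M :
  0 < r < r' -> 0 < M ->
  exists D C Y0 : R, 0 <= D /\ 0 <= C /\ 1 <= Y0 /\
    forall eps, 0 < eps -> 0 < log2 (/ eps) -> Y0 <= ln (log2 (/ eps)) ->
    exists h,
      is_metric_entropy (disk_dist r) (bounded_analytic r) (analytic_class r' M) eps h /\
      let L := log2 (/ eps) in let y := ln L in
      Rabs (h - L ^ 2 / log2 (r' / r))
        <= L / log2 (r' / r) * log2 L
           * ((1 + D / y) * (1 + 2 * (ln y / y) + C / y)).
Proof.
intros Hr HM.
destruct (entropy_in_n r r' M Hr HM) as [D [C [HD [HC Hmain]]]].
set (La := ln (r' / r)) in *.
assert (HLa : 0 < La).
{ unfold La. rewrite <- ln_1. apply ln_increasing; [lra|].
  apply Rmult_lt_reg_r with r; [lra|].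
  replace (r' / r * r) with r' by (field; lra). lra. }
assert (H2 : 0 < ln 2) by (rewrite <- ln_1; apply ln_increasing; lra).
set (E := ln 2 / La + D).
assert (HE : 0 < E).
{ assert (0 < ln 2 / La) by now apply Rdiv_lt_0_compat. unfold E; lra. }
set (c := Rabs (ln E)). assert (Hc : 0 <= c) by apply Rabs_pos.
assert (Hc' : ln E <= c) by apply Rle_abs.
set (W := 2 * ln (26 + 2 * sqrt 2 * ln 100)).
assert (HW : 0 <= W).
{ unfold W. assert (S2 := sqrt_pos 2).
  assert (0 <= ln 100) by (rewrite <- ln_1; apply ln_le; lra).
  assert (0 <= sqrt 2 * ln 100) by now apply Rmult_le_pos.
  assert (0 <= ln (26 + 2 * sqrt 2 * ln 100)); [|lra].
  rewrite <- ln_1. apply ln_le; lra. }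
set (D' := D * La / ln 2).
set (C' := 3 * c + W + C).
(* [y >= Y0] makes [eps] small enough and [n] at least [3] *)
set (Y0 := 1 + 3 * La / ln 2).
assert (P3 : 0 < 3 * La / ln 2) by (apply Rdiv_lt_0_compat; lra).
exists D', C', Y0. split.
{ unfold D'. apply Rdiv_le_0_compat; [apply Rmult_le_pos; lra|easy]. }
split; [unfold C'; lra|]. split; [unfold Y0; lra|].
intros eps He HL0 HY. set (L := log2 (/ eps)) in *. set (y := ln L) in *.
assert (Hy : 1 <= y) by (unfold Y0 in HY; lra).
assert (HyL : y <= L).
{ assert (Q := exp_ineq1_le y). unfold y in Q at 2. rewrite exp_ln in Q by easy. lra. }
assert (EL : ln (/ eps) = L * ln 2) by (unfold L, log2; field; lra).
assert (Hl3 : 3 * La < L * ln 2).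
{ assert (3 * La / ln 2 < L) by (unfold Y0 in HY; lra).
  apply Rmult_lt_reg_r with (/ ln 2); [now apply Rinv_0_lt_compat|].
  replace (L * ln 2 * / ln 2) with L by (field; lra). unfold Rdiv in *. lra. }
destruct (Hmain eps) as [n [N [Hn [HN HB]]]].
{ split; [easy|]. rewrite <- (Rinv_inv eps), exp_Ropp.
  apply Rinv_lt_contravar.
  - apply Rmult_lt_0_compat; [apply exp_pos|now apply Rinv_0_lt_compat].
  - rewrite <- (exp_ln (/ eps)) by now apply Rinv_0_lt_compat.
    rewrite EL. apply exp_increasing. lra. }
rewrite EL in *.
set (l := L * ln 2) in *.
exists (log2 (INR N)). split; [now exists N|]. cbv zeta. fold y.
assert (Elog : log2 (r' / r) = La / ln 2) by reflexivity.
assert (Hln2 : L / log2 (r' / r) * log2 L = l / La * y / ln 2).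
{ rewrite Elog. unfold log2. fold y. unfold l. field. lra. }
rewrite Hln2, Elog.
replace (log2 (INR N) - L ^ 2 / (La / ln 2)) with ((ln (INR N) - l ^ 2 / La) / ln 2)
  by (unfold log2, l; field; lra).
rewrite Rabs_div, (Rabs_pos_eq (ln 2)) by lra.
set (beta := (1 + D' / y) * (1 + 2 * (ln y / y) + C' / y)).
replace (l / La * y / ln 2 * beta) with (l / La * y * beta / ln 2) by (field; lra).
apply Rmult_le_compat_r; [left; now apply Rinv_0_lt_compat|].
eapply Rle_trans; [exact HB|].
assert (HlLa : l / La = L * (ln 2 / La)) by (unfold l; field; lra).
assert (Pl : 0 < l) by lra.
assert (PlLa : 0 < l / La) by now apply Rdiv_lt_0_compat.
assert (Hn3 : 3 <= INR n).
{ assert (3 < l / La); [|lra].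
  apply Rmult_lt_reg_r with La; [easy|].
  replace (l / La * La) with l by (field; lra). lra. }
assert (Bn : INR n <= l / La * (1 + D' / y)).
{ eapply Rle_trans; [apply Hn|].
  rewrite Rmult_plus_distr_l, Rmult_1_r. apply Rplus_le_compat_l.
  replace (l / La * (D' / y)) with (D * (L / y)) by (unfold l, D'; field; lra).
  rewrite <- (Rmult_1_r D) at 1. apply Rmult_le_compat_l; [easy|].
  apply Rmult_le_reg_r with y; [lra|].
  replace (L / y * y) with L by (field; lra). lra. }
assert (Bln : ln (INR n) <= y + c).
{ apply Rle_trans with (ln (L * E)).
  - apply ln_le; [lra|]. eapply Rle_trans; [apply Hn|]. rewrite HlLa. unfold E. nra.
  - rewrite ln_mult by easy. fold y. lra. }
assert (L1 : 1 <= ln (INR n)).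
{ rewrite <- (ln_exp 1). apply ln_le; [apply exp_pos|]. generalize exp_le_3. lra. }
assert (Blnln : ln (ln (INR n)) <= ln y + c).
{ rewrite <- (ln_exp c) at 1. rewrite <- ln_mult by (lra || apply exp_pos).
  apply ln_le; [lra|]. eapply Rle_trans; [exact Bln|].
  assert (Q := exp_ineq1_le c). nra. }
assert (Bs := ln_spread_le n Hn3). fold W in Bs.
assert (Hlny : 0 <= ln y) by (rewrite <- ln_1; apply ln_le; lra).
assert (Fac : 2 * ln (spread n) + C <= y * (1 + 2 * (ln y / y) + C' / y)).
{ replace (y * (1 + 2 * (ln y / y) + C' / y)) with (y + 2 * ln y + C') by (field; lra).
  unfold C'. lra. }
replace (l / La * y * beta)
  with (l / La * (1 + D' / y) * (y * (1 + 2 * (ln y / y) + C' / y)))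
  by (unfold beta; ring).
apply Rle_trans with (INR n * (y * (1 + 2 * (ln y / y) + C' / y))).
- apply Rmult_le_compat_l; [apply pos_INR|exact Fac].
- apply Rmult_le_compat_r; [|exact Bn].
  replace (y * (1 + 2 * (ln y / y) + C' / y)) with (y + 2 * ln y + C') by (field; lra).
  unfold C'. lra.
Qed.

Lemma log2_inv_large K : at_right 0 (fun eps => 0 < log2 (/ eps) /\ K <= ln (log2 (/ eps))).
Proof.
assert (H2 : 0 < ln 2) by (rewrite <- ln_1; apply ln_increasing; lra).
exists (mkposreal (exp (- (exp K * ln 2))) (exp_pos _)). intros eps Hb He.
unfold ball in Hb; simpl in Hb. unfold AbsRing_ball, abs, minus, plus, opp in Hb; simpl in Hb.
rewrite Ropp_0, Rplus_0_r, Rabs_pos_eq in Hb by lra.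
assert (HL : exp K < log2 (/ eps)).
{ unfold log2. rewrite ln_Rinv by easy.
  apply ln_increasing in Hb; [|easy]. rewrite ln_exp in Hb.
  apply Rmult_lt_reg_r with (ln 2); [easy|].
  replace (- ln eps / ln 2 * ln 2) with (- ln eps) by (field; lra). lra. }
assert (PK := exp_pos K). split; [lra|].
rewrite <- (ln_exp K). apply ln_le; lra.
Qed.

Lemma correction_tends_to_1 D C e :
  0 <= D -> 0 <= C -> 0 < e ->
  exists Y, 1 <= Y /\ forall y, Y <= y ->
    (1 + D / y) * (1 + 2 * (ln y / y) + C / y) < 1 + e.
Proof.
intros HD HC He.
set (Q := D + (2 + C) + D * (2 + C)).
assert (HDC : 0 <= D * (2 + C)) by (apply Rmult_le_pos; lra).
set (t := Rmin 1 (e / (Q + 1))).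
assert (Ht : 0 < t).
{ apply Rmin_glb_lt; [lra|]. apply Rdiv_lt_0_compat; unfold Q; lra. }
assert (t1 : t <= 1) by apply Rmin_l.
assert (t2 : t * Q < e).
{ apply Rle_lt_trans with (e / (Q + 1) * Q).
  - apply Rmult_le_compat_r; [unfold Q; lra|apply Rmin_r].
  - apply Rmult_lt_reg_r with (Q + 1); [unfold Q; lra|].
    replace (e / (Q + 1) * Q * (Q + 1)) with (e * Q) by (field; unfold Q; lra). nra. }
assert (H := proj2 (is_lim_spec _ _ _) is_lim_div_ln_p (mkposreal t Ht)).
destruct H as [Y1 HY1]. simpl in HY1.
exists (Rmax 1 (Rmax (Y1 + 1) (/ t))). split; [apply Rmax_l|]. intros y Hy.
assert (y1 := Rle_trans _ _ _ (Rmax_l _ _) Hy).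
assert (y23 := Rle_trans _ _ _ (Rmax_r _ _) Hy).
assert (y2 := Rle_trans _ _ _ (Rmax_l _ _) y23).
assert (y3 := Rle_trans _ _ _ (Rmax_r _ _) y23).
specialize (HY1 y ltac:(lra)). rewrite Rminus_0_r in HY1.
apply Rabs_lt_between in HY1.
assert (Hi : 0 <= / y <= t).
{ split; [left; apply Rinv_0_lt_compat; lra|].
  rewrite <- (Rinv_inv t). apply Rinv_le_contravar; [now apply Rinv_0_lt_compat|easy]. }
assert (0 <= ln y / y).
{ apply Rdiv_le_0_compat; [|lra]. rewrite <- ln_1. apply ln_le; lra. }
assert (B1 : 0 <= D / y <= D * t).
{ unfold Rdiv. split; [apply Rmult_le_pos; lra|apply Rmult_le_compat_l; lra]. }
assert (B2 : 0 <= C / y <= C * t).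
{ unfold Rdiv. split; [apply Rmult_le_pos; lra|apply Rmult_le_compat_l; lra]. }
apply Rle_lt_trans with ((1 + D * t) * (1 + (2 + C) * t)).
- apply Rmult_le_compat; lra.
- assert (D * t * ((2 + C) * t) <= D * (2 + C) * t).
  { replace (D * t * ((2 + C) * t)) with (D * (2 + C) * t * t) by ring.
    rewrite <- (Rmult_1_r (D * (2 + C) * t)) at 2.
    apply Rmult_le_compat_l; [|easy]. apply Rmult_le_pos; lra. }
  unfold Q in t2. lra.
Qed.

Theorem theorem14 (r r' M : R) (hr : 0 < r) (hrr' : r < r') (hM : 0 < M) :
  exists gamma : R -> R,
    (forall eps : R, 0 < eps -> Rabs (gamma eps) <= 1) /\
    exists o : R -> R,
      filterlim o (at_right 0) (locally 0) /\
      at_right 0 (fun eps : R =>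
        is_metric_entropy (disk_dist r) (bounded_analytic r)
          (analytic_class r' M) eps
          ((log2 (/ eps)) ^ 2 / log2 (r' / r)
           + log2 (/ eps) / log2 (r' / r) * log2 (log2 (/ eps))
             * (gamma eps + o eps))).
Proof.
destruct (entropy_estimate r r' M (conj hr hrr') hM)
  as [D [C [Y0 [HD [HC [HY0 H]]]]]].
assert (H2 : 0 < ln 2) by (rewrite <- ln_1; apply ln_increasing; lra).
assert (HLa : 0 < log2 (r' / r)).
{ unfold log2. apply Rdiv_lt_0_compat; [|easy]. rewrite <- ln_1.
  apply ln_increasing; [lra|]. apply Rmult_lt_reg_r with r; [lra|].
  replace (r' / r * r) with r' by (field; lra). lra. }
destruct (fun_choice (fun eps h =>
    0 < eps -> 0 < log2 (/ eps) -> Y0 <= ln (log2 (/ eps)) ->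
    is_metric_entropy (disk_dist r) (bounded_analytic r) (analytic_class r' M) eps h /\
    let L := log2 (/ eps) in let y := ln L in
    Rabs (h - L ^ 2 / log2 (r' / r))
      <= L / log2 (r' / r) * log2 L * ((1 + D / y) * (1 + 2 * (ln y / y) + C / y))))
  as [h Hh].
{ intros eps.
  destruct (classic (0 < eps /\ 0 < log2 (/ eps) /\ Y0 <= ln (log2 (/ eps))))
    as [[e0 [e1 e2]]|N].
  - destruct (H eps e0 e1 e2) as [h Hh]. now exists h.
  - exists 0. intros. exfalso. tauto. }
set (scale := fun eps => log2 (/ eps) / log2 (r' / r) * log2 (log2 (/ eps))).
set (G := fun eps => (h eps - log2 (/ eps) ^ 2 / log2 (r' / r)) / scale eps).
(* [G] is the exact coefficient of the second term; [gamma] is its truncation to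
   [[-1, 1]], so that [o] only measures by how much [|G|] exceeds [1] *)
set (gamma := fun eps => Rmax (-1) (Rmin 1 (G eps))).
assert (Hscale : forall eps, 0 < log2 (/ eps) -> Y0 <= ln (log2 (/ eps)) -> 0 < scale eps).
{ intros eps e1 e2. unfold scale. apply Rmult_lt_0_compat.
  - now apply Rdiv_lt_0_compat.
  - unfold log2 at 1. apply Rdiv_lt_0_compat; lra. }
exists gamma. split.
{ intros eps _. unfold gamma. apply Rabs_le_between. split; [apply Rmax_l|].
  apply Rmax_lub; [lra|apply Rmin_l]. }
exists (fun eps => G eps - gamma eps). split.
- apply filterlim_locally. intros [e He].
  destruct (correction_tends_to_1 D C e HD HC He) as [Y [HY HYe]].
  apply (filter_imp (fun eps => 0 < eps /\
     (0 < log2 (/ eps) /\ Rmax Y Y0 <= ln (log2 (/ eps))))).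
  + intros eps [e0 [e1 e2]].
    assert (y1 := Rle_trans _ _ _ (Rmax_l _ _) e2).
    assert (y2 := Rle_trans _ _ _ (Rmax_r _ _) e2).
    destruct (Hh eps e0 e1 y2) as [_ B]. cbv zeta in B.
    specialize (HYe _ y1). assert (Ps := Hscale eps e1 y2).
    set (beta := (1 + D / ln (log2 (/ eps))) *
      (1 + 2 * (ln (ln (log2 (/ eps))) / ln (log2 (/ eps))) + C / ln (log2 (/ eps)))) in *.
    assert (BG : Rabs (G eps) <= beta).
    { unfold G, Rdiv at 1. rewrite Rabs_mult, (Rabs_pos_eq (/ _))
        by (left; now apply Rinv_0_lt_compat).
      apply Rmult_le_reg_r with (scale eps); [easy|].
      rewrite Rmult_assoc, Rinv_l, Rmult_1_r by lra.
      rewrite (Rmult_comm beta). exact B. }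
    apply Rabs_le_between in BG.
    change (Rabs (G eps - gamma eps - 0) < e). rewrite Rminus_0_r. unfold gamma.
    apply Rabs_lt_between. unfold Rmax, Rmin.
    destruct (Rle_dec 1 (G eps)); destruct (Rle_dec (-1) _); lra.
  + apply filter_and.
    * exists (mkposreal 1 Rlt_0_1). now intros.
    * apply log2_inv_large.
- apply (filter_imp (fun eps => 0 < eps /\
     (0 < log2 (/ eps) /\ Y0 <= ln (log2 (/ eps))))).
  + intros eps [e0 [e1 e2]]. destruct (Hh eps e0 e1 e2) as [Ent _].
    assert (Ps := Hscale eps e1 e2).
    replace (gamma eps + (G eps - gamma eps)) with (G eps) by ring.
    fold (scale eps).
    replace (log2 (/ eps) ^ 2 / log2 (r' / r) + scale eps * G eps) with (h eps)
      by (unfold G; field; lra).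
    exact Ent.
  + apply filter_and.
    * exists (mkposreal 1 Rlt_0_1). now intros.
    * apply log2_inv_large.
Qed.
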